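(* Let $p$ be an odd prime. Any non-trivial Rota--Baxter operator on $H_3$ is, up to conjugation by automorphisms of $H_3$ and the action $\widetilde{\ }$, equal to one of the following operators, given by their parameter tuples $\chi(B)=(l_\alpha,l_\beta,m_\alpha,m_\beta,x_\alpha,x_\beta,k)\in\mathbb{Z}_p^7$: \begin{itemize} \item $B^1_{k,m}$: $(0,-1,k(m+1),m,0,0,k)$, $1\le k<(p-1)/2$, $m\in\mathbb{Z}_p\setminus\{-1\}$; \item $B^2_k$: $(0,0,0,-1,0,0,k)$, $1\le k<(p-1)/2$; \item $B^3_m$: $(m,0,0,m,0,0,m^2/(2m+1))$, $1\le m<(p-1)/2$; \item $O^1_m$: $(0,-1,\frac{p-1}{2}(m+1),m,0,0,\frac{p-1}{2})$, $0\le m<(p-1)/2$; \item $O^2$: $(0,0,0,-1,0,0,\frac{p-1}{2})$; \item $B^4$: $(0,0,0,0,1,0,0)$; \item $B^5$: $(0,1,0,0,1,0,0)$; \item $B^6$: $(0,1,0,0,0,0,0)$; \item $B^7_m$: $(0,0,0,m,1,0,0)$, $m\in\mathbb{Z}_p^*$; \item $B^8_m$: $(0,0,0,m,0,0,0)$, $m\in\mathbb{Z}_p^*$. \end{itemize} Moreover, the operators in this list (for all the indicated parameter values) lie in pairwise different orbits.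
   Context: Convention: $[g,h]=g^{-1}h^{-1}gh$. The finite Heisenberg group is $H_3=\langle a,b,c\mid [a,b]=c,\ [a,c]=[b,c]=a^p=b^p=c^p=e\rangle$, of order $p^3$; every element is uniquely $b^sa^tc^r$ with $s,t,r\in\mathbb{Z}_p=\mathbb{Z}/p\mathbb{Z}$. A Rota--Baxter operator on a group $G$ is a map $B\colon G\to G$ such that $B(g)B(h)=B\big(gB(g)hB(g)^{-1}\big)$ for all $g,h\in G$. The trivial Rota--Baxter operators are $g\mapsto e$ and $g\mapsto g^{-1}$. Every Rota--Baxter operator on $H_3$ has the form $$B(b^sa^tc^r)=b^{m_\alpha t+m_\beta s}\,a^{l_\alpha t+l_\beta s}\,c^{B_\gamma(t,s,r)},$$ $$B_\gamma(t,s,r)=x_\alpha t+x_\beta s+(l_\beta m_\alpha+km_\beta)ts+m_\alpha(l_\alpha+k)\tfrac{t(t-1)}{2}+l_\beta(m_\beta-k)\tfrac{s(s-1)}{2}+kr,$$ for a unique tuple $\chi(B)=(l_\alpha,l_\beta,m_\alpha,m_\beta,x_\alpha,x_\beta,k)\in\mathbb{Z}_p^7$, and a tuple defines a Rota--Baxter operator in this way if and only if $l_\alpha m_\beta-kl_\alpha=l_\beta m_\alpha+km_\beta+k$ in $\mathbb{Z}_p$. If $B$ is a Rota--Baxter operator on $G$, then so are $\widetilde B$, where $\widetilde B(g)=g^{-1}B(g^{-1})$, and $\varphi^{-1}\circ B\circ\varphi$ for every $\varphi\in\mathrm{Aut}(G)$. ''Up to conjugation and the action $\widetilde{\ }$''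 and ''orbit'' refer to the equivalence relation on Rota--Baxter operators generated by $B\sim\varphi^{-1}\circ B\circ\varphi$ ($\varphi\in\mathrm{Aut}(G)$) and $B\sim\widetilde B$. *)

(* Defs.v *)
From Stdlib Require Export Relation_Operators.
From mathcomp Require Export all_boot all_order all_fingroup all_algebra all_solvable.

Set Implicit Arguments.
Unset Strict Implicit.
Unset Printing Implicit Defensive.

Import GRing.Theory GroupScope.

(* The first six fields make a, b, c generators satisfying the relations; the
   last one says that gT is isomorphic to the presented group.  As gT is finite,
   the resulting surjection from the presented group onto gT is an isomorphism,
   so that (gT, a, b, c) is the presented group with its named generators. *)
Record heisenberg (p : nat) (gT : finGroupType) (a b c : gT) : Prop :=
  Heisenberg {
    heisenberg_gen : <<[set a; b; c]>> = [set: gT];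
    heisenberg_ab : [~ a, b] = c;
    heisenberg_ac : [~ a, c] = 1;
    heisenberg_bc : [~ b, c] = 1;
    heisenberg_exp : [/\ a ^+ p = 1, b ^+ p = 1 & c ^+ p = 1];
    heisenberg_pres : [set: gT] \isog Grp (x : y : z :
      [~ x, y] = z, [~ x, z], [~ y, z], x ^+ p, y ^+ p, z ^+ p)
  }.

Definition rota_baxter (gT : finGroupType) (B : {ffun gT -> gT}) : Prop :=
  forall g h : gT, B g * B h = B (g * B g * h * (B g)^-1).

Definition rb_trivial (gT : finGroupType) (B : {ffun gT -> gT}) : Prop :=
  (forall g, B g = 1) \/ (forall g, B g = g^-1).

Definition rb_tilde (gT : finGroupType) (B : {ffun gT -> gT}) :
  {ffun gT -> gT} := [ffun g => g^-1 * B g^-1].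

Definition rb_conj (gT : finGroupType) (phi : {perm gT})
  (B : {ffun gT -> gT}) : {ffun gT -> gT} :=
  [ffun g => (phi^-1 : {perm gT}) (B (phi g))].

Definition rb_step (gT : finGroupType) (B B' : {ffun gT -> gT}) : Prop :=
  [/\ rota_baxter B, rota_baxter B' &
      (exists2 phi : {perm gT}, phi \in Aut [set: gT] & B' = rb_conj phi B)
      \/ B' = rb_tilde B].

Definition rb_equiv (gT : finGroupType) :
  {ffun gT -> gT} -> {ffun gT -> gT} -> Prop :=
  clos_refl_sym_trans {ffun gT -> gT} (@rb_step gT).

Record rb_params (p : nat) : Type := RBParams {
  l_alpha : 'F_p; l_beta : 'F_p;
  m_alpha : 'F_p; m_beta : 'F_p;
  x_alpha : 'F_p; x_beta : 'F_p;
  k_gamma : 'F_p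
}.

Definition B_gamma (p : nat) (chi : rb_params p) (t s r : 'F_p) : 'F_p :=
  let: RBParams la lb ma mb xa xb k := chi in
  (xa * t + xb * s + (lb * ma + k * mb) * t * s
   + ma * (la + k) * (t * (t - 1) / 2%:R)
   + lb * (mb - k) * (s * (s - 1) / 2%:R) + k * r)%R.

(* For p prime, 'F_p is Z/pZ and exponents in 'F_p are coerced to their representatives in [0, p). *)
Definition heis_elt (p : nat) (gT : finGroupType) (a b c : gT)
  (s t r : 'F_p) : gT := b ^+ s * a ^+ t * c ^+ r.

Definition has_chi (p : nat) (gT : finGroupType) (a b c : gT)
  (B : {ffun gT -> gT}) (chi : rb_params p) : Prop :=
  forall s t r : 'F_p,
    B (heis_elt a b c s t r) =
    heis_elt a b c (m_alpha chi * t + m_beta chi * s)%R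
                   (l_alpha chi * t + l_beta chi * s)%R
                   (B_gamma chi t s r).

(* Indices ranging over an interval are natural numbers (cast to 'F_p in
   label_params); indices ranging over Z_p minus a point are elements of 'F_p. *)
Inductive rb_label (p : nat) : Type :=
  | LB1 of nat & 'F_p
  | LB2 of nat
  | LB3 of nat
  | LO1 of nat
  | LO2
  | LB4
  | LB5
  | LB6
  | LB7 of 'F_p
  | LB8 of 'F_p.

Arguments LO2 {p}.
Arguments LB4 {p}.
Arguments LB5 {p}.
Arguments LB6 {p}.

Definition label_ok (p : nat) (L : rb_label p) : bool :=
  match L with
  | LB1 k m => (1 <= k < (p - 1) %/ 2)%N && (m != -1)%R
  | LB2 k => (1 <= k < (p - 1) %/ 2)%N
  | LB3 m => (1 <= m < (p - 1) %/ 2)%N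
  | LO1 m => (0 <= m < (p - 1) %/ 2)%N
  | LB7 m => (m != 0)%R
  | LB8 m => (m != 0)%R
  | LO2 | LB4 | LB5 | LB6 => true
  end.

Definition label_params (p : nat) (L : rb_label p) : rb_params p :=
  let h : 'F_p := (((p - 1) %/ 2)%N%:R)%R in
  match L with
  | LB1 k m => RBParams 0 (-1) (k%:R * (m + 1)) m 0 0 k%:R
  | LB2 k => RBParams 0 0 0 (-1) 0 0 k%:R
  | LB3 m => RBParams m%:R 0 0 m%:R 0 0 (m%:R ^+ 2 / (2%:R * m%:R + 1))
  | LO1 m => RBParams 0 (-1) (h * (m%:R + 1)) m%:R 0 0 h
  | LO2 => RBParams 0 0 0 (-1) 0 0 h
  | LB4 => RBParams 0 0 0 0 1 0 0
  | LB5 => RBParams 0 1 0 0 1 0 0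
  | LB6 => RBParams 0 1 0 0 0 0 0
  | LB7 m => RBParams 0 0 0 m 1 0 0
  | LB8 m => RBParams 0 0 0 m 0 0 0
  end%R.

Definition listed_operator (p : nat) (gT : finGroupType) (a b c : gT)
  (L : rb_label p) (B : {ffun gT -> gT}) : Prop :=
  [/\ label_ok L, rota_baxter B & has_chi a b c B (label_params L)].

(* Main.v *)
(* In symmetric coordinates the group law of H_3 is (v, r)(w, q) =
   (v + w, r + q + w(v, w) / 2) with w the symplectic form on the plane.  A
   Rota-Baxter operator preserves the centre, and is then given by a linear map
   L, a linear form x and a scalar k, subject to det L = k (tr L + 1).  An
   automorphism given by A and y conjugates L by A and moves x by the row space
   of k - L, while the tilde action is (L, x, k) |-> (-1 - L, -x, -1 - k).
   Hence k, tr L, whether L is scalar, and whether x lies in the row space of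
   k - L determine the conjugacy class; this uses that a nonscalar L has a
   cyclic vector and that det (k - L) = k (k + 1).  The list consists of one
   representative for each value of these invariants, modulo
   (k, tr L) |-> (-1 - k, -2 - tr L). *)

Require Import Defs.
From mathcomp Require Import ring zify.

Set Implicit Arguments.
Unset Strict Implicit.
Unset Printing Implicit Defensive.

Import GRing.Theory GroupScope.

(** The shape of the list comes from the fixed points of the tilde action. On k the only one is
    (p-1)/2; there tilde still identifies the traces m and -2-m, with fixed point -1, which produces
    the half range of [LO1] and the single [LO2]. For a scalar L = l the constraint reads l^2 = k
    (2l + 1), so l determines k, and the fixed point l = (p-1)/2 of l |-> -1-l does not occur: 2l +
    1 = 0 would force l = 0. This is why [LB3] has no exceptional companion. The matrix k - L is
    singular only for k = 0 and k = -1, which tilde exchanges, so k = 0 suffices; there a scalar L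
    vanishes, x = 0 is a trivial operator, and every other x can be moved to (1, 0). Distinctness
    needs no analysis of chains of equivalences: a function from invariants to labels that is
    constant under both kinds of step and returns the label of each listed operator separates the
    orbits. *)

Record heis_coords (p : nat) (gT : finGroupType)
    (S : 'F_p -> 'F_p -> 'F_p -> gT) : Prop := HeisCoords {
  coordsM : forall t s r t' s' r', S t s r * S t' s' r' =
    S (t + t')%R (s + s')%R (r + r' + (t * s' - t' * s) / 2%:R)%R;
  coords_inj : forall t s r t' s' r', S t s r = S t' s' r' ->
    [/\ t = t', s = s' & r = r'];
  coords_onto : forall g, exists t s r, g = S t s r
}.

(** The shift by t s / 2 turns the central term t s' of the product in [heis_elt] form into the
    antisymmetric (t s' - t' s) / 2. *)
Definition sym_elt (p : nat) (gT : finGroupType) (a b c : gT)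
    (t s r : 'F_p) : gT :=
  heis_elt a b c s t (r + t * s / 2%:R)%R.

Lemma Fp_two_neq0 (p : nat) : prime p -> odd p -> ((2%:R : 'F_p) != 0)%R.
Proof.
move=> p_pr p_odd; apply/eqP => /(congr1 (@nat_of_ord _)).
rewrite val_Fp_nat //= .
rewrite modn_small // ltn_neqAle prime_gt1 // andbT.
by apply: contraTneq p_odd => <-.
Qed.

(** * Powers with exponents in ['F_p] *)

Section PowersInFp.

Variables (p : nat) (gT : finGroupType).
Hypothesis p_pr : prime p.
Implicit Types (x : gT) (t s : 'F_p).

Lemma expg_Fp_nat x n : x ^+ p = 1 -> x ^+ (n%:R : 'F_p)%R = x ^+ n.
Proof. by move=> xp; rewrite val_Fp_nat // expg_mod. Qed.

Lemma expg_FpD x t s : x ^+ p = 1 -> x ^+ (t + s)%R = x ^+ t * x ^+ s.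
Proof.
by move=> xp; rewrite -expgD -(expg_Fp_nat (t + s) xp) natrD !natr_Zp.
Qed.

Lemma expg_FpM x t s : x ^+ p = 1 -> x ^+ (t * s)%R = x ^+ (t * s)%N.
Proof. by move=> xp; rewrite -(expg_Fp_nat (t * s) xp) natrM !natr_Zp. Qed.

End PowersInFp.

(** The extraspecial group [p^{1+2}] satisfies the presentation with z = [x, y], so it is a
    homomorphic image of the group. Oddness of p gives it exponent p, whence z^p = 1. *)
Lemma heisenberg_card (p : nat) (gT : finGroupType) (a b c : gT) :
  prime p -> odd p -> heisenberg p a b c -> (p ^ 3 <= #|[set: gT]|)%N.
Proof.
move=> p_pr p_odd [_ _ _ _ _ pres]; rewrite -(card_pX1p2 p_pr).
have /homgP[f <-] : p^{1+2} \homg [set: gT].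
  rewrite pres; case/existsP: (isoGrp_hom (Grp_pX1p2 p_pr)) => [[x y]] /=.
  case/eqP=> gen xp yp xyx xyy.
  apply/existsP; exists (x, y, [~ x, y]) => /=.
  have zp : [~ x, y] ^+ p = 1.
    by apply: (exponentP (exponent_pX1p2 p_pr p_odd)); rewrite inE.
  have xz : [~ x, [~ x, y]] = 1 by apply/eqP/commgP/commute_sym/commgP/eqP.
  have yz : [~ y, [~ x, y]] = 1 by apply/eqP/commgP/commute_sym/commgP/eqP.
  rewrite !xpair_eqE xz yz xp yp zp !eqxx !andbT -gen.
  apply/eqP/joing_idPl; rewrite cycle_subG groupR //.
    by rewrite mem_gen // inE cycle_id.
  by rewrite mem_gen // inE cycle_id orbT.
exact: leq_morphim.
Qed.

(** * Symmetric coordinates on the Heisenberg group *)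

Section Coordinates.

Variables (p : nat) (gT : finGroupType) (a b c : gT).
Hypotheses (p_pr : prime p) (p_odd : odd p) (H3 : heisenberg p a b c).

Let two_neq0 := Fp_two_neq0 p_pr p_odd.
Let ap : a ^+ p = 1. Proof. by case: H3 => _ _ _ _ []. Qed.
Let bp : b ^+ p = 1. Proof. by case: H3 => _ _ _ _ []. Qed.
Let cp : c ^+ p = 1. Proof. by case: H3 => _ _ _ _ []. Qed.
Let ca : commute c a.
Proof. by apply/commute_sym/commgP/eqP; case: H3. Qed.
Let cb : commute c b.
Proof. by apply/commute_sym/commgP/eqP; case: H3. Qed.

Lemma expg_heis_comm m n : a ^+ m * b ^+ n = b ^+ n * a ^+ m * c ^+ (m * n).
Proof.
have ab : [~ a, b] = c by case: H3.
rewrite [LHS]commgC commXXg ab //; exact: commute_sym.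
Qed.

Lemma heis_eltM (s t r s' t' r' : 'F_p) :
  heis_elt a b c s t r * heis_elt a b c s' t' r' =
  heis_elt a b c (s + s')%R (t + t')%R (r + r' + t * s')%R.
Proof.
rewrite /heis_elt !expg_FpD // expg_FpM // -!mulgA; congr (_ * _).
have cX x i j : commute c x -> c ^+ i * x ^+ j = x ^+ j * c ^+ i.
  by move=> cx; apply/commuteX2.
rewrite [c ^+ r * (b ^+ s' * _)]mulgA (cX b) // -[b ^+ s' * _ * _]mulgA.
rewrite [a ^+ t * (b ^+ s' * _)]mulgA expg_heis_comm -!mulgA.
congr (_ * (_ * _)); rewrite [c ^+ r * (a ^+ t' * _)]mulgA (cX a) // -!mulgA.
rewrite [c ^+ (t * s') * (a ^+ t' * _)]mulgA (cX a) // -!mulgA.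
congr (_ * _).
by rewrite -!expgD addnC -addnA.
Qed.

Lemma sym_eltM (t s r t' s' r' : 'F_p) :
  sym_elt a b c t s r * sym_elt a b c t' s' r' =
  sym_elt a b c (t + t')%R (s + s')%R
    (r + r' + (t * s' - t' * s) / 2%:R)%R.
Proof. by rewrite /sym_elt heis_eltM; congr heis_elt; field. Qed.

Let sym_elt000 : sym_elt a b c (0 : 'F_p)%R 0%R 0%R = 1.
Proof. by rewrite /sym_elt /heis_elt !mul0r addr0 !expg0 !mulg1. Qed.

Let Fp1 : (1%R : 'F_p) = 1%N :> nat.
Proof. by rewrite /= modn_small // Fp_cast // prime_gt1. Qed.

Let sym_elt100 : sym_elt a b c (1 : 'F_p)%R 0%R 0%R = a.
Proof. by rewrite /sym_elt /heis_elt mulr0 mul0r addr0 !expg0 mulg1 mul1g Fp1. Qed.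

Let sym_elt010 : sym_elt a b c (0 : 'F_p)%R 1%R 0%R = b.
Proof. by rewrite /sym_elt /heis_elt !mul0r addr0 !expg0 !mulg1 Fp1. Qed.

Let sym_elt001 : sym_elt a b c (0 : 'F_p)%R 0%R 1%R = c.
Proof. by rewrite /sym_elt /heis_elt !mul0r addr0 !expg0 !mul1g Fp1. Qed.

(** The values of [sym_elt] are closed under the product, hence form a subgroup, and they include
    the generators. *)
Lemma sym_elt_onto g : exists t s r : 'F_p, g = sym_elt a b c t s r.
Proof.
pose S (u : 'F_p * 'F_p * 'F_p) := sym_elt a b c u.1.1 u.1.2 u.2.
have gS : group_set [set S u | u : 'F_p * 'F_p * 'F_p].
  apply/group_setP; split; first by apply/imsetP; exists (0, 0, 0)%R.
  move=> _ _ /imsetP[u _ ->] /imsetP[v _ ->]; rewrite /S sym_eltM.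
  by apply/imsetP; exists (u.1.1 + v.1.1, u.1.2 + v.1.2,
    u.2 + v.2 + (u.1.1 * v.1.2 - v.1.1 * u.1.2) / 2%:R)%R.
have: g \in Group gS.
  have: <<[set a; b; c]>> \subset Group gS; last first.
    by case: H3 => -> *; apply: (subsetP _ _ (in_setT g)).
  rewrite gen_subG; apply/subsetP => x; rewrite !inE -orbA.
  by case/or3P=> /eqP->; apply/imsetP;
    [exists (1, 0, 0)%R | exists (0, 1, 0)%R | exists (0, 0, 1)%R].
by case/imsetP=> u _ ->; exists u.1.1, u.1.2, u.2.
Qed.

Lemma sym_elt_coords : heis_coords (sym_elt a b c : 'F_p -> _).
Proof.
split; [exact: sym_eltM | | exact: sym_elt_onto] => t s r t' s' r' eqS.
pose S (u : 'F_p * 'F_p * 'F_p) := sym_elt a b c u.1.1 u.1.2 u.2.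
have onS : codom S =i predT.
  move=> g; have [t1 [s1 [r1 ->]]] := sym_elt_onto g.
  by apply/codomP; exists (t1, s1, r1).
(* A map from p^3 triples onto a group of at least p^3 elements is injective. *)
have /injectiveP injS : injectiveb S.
  apply/card_uniqP; rewrite (eq_card onS) size_codom !card_prod card_Fp //.
  have := heisenberg_card p_pr p_odd H3; rewrite cardsT => le_p3.
  have := card_size (codom S); rewrite (eq_card onS) size_codom.
  rewrite !card_prod card_Fp // => ge_p3.
  by apply/anti_leq; rewrite ge_p3 /= -mulnA.
by case: (injS (t, s, r) (t', s', r') eqS) => -> -> ->.
Qed.

End Coordinates.

(** * Rota-Baxter operators in symmetric coordinates *)

Definition valid_params (p : nat) (d : rb_params p) : Prop :=
  (l_alpha d * m_beta d - k_gamma d * l_alpha d =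
   l_beta d * m_alpha d + k_gamma d * m_beta d + k_gamma d)%R.

(* With linear part L = [l_alpha, l_beta; m_alpha, m_beta] and symplectic form w,
   the central coordinate of the image of (v, r) is x v - k / 2 w(L v, v) + k r. *)
Definition sym_params (p : nat) (gT : finGroupType)
    (S : 'F_p -> 'F_p -> 'F_p -> gT) (d : rb_params p) (B : gT -> gT) : Prop :=
  forall t s r : 'F_p, B (S t s r) =
    S (l_alpha d * t + l_beta d * s)%R (m_alpha d * t + m_beta d * s)%R
      (x_alpha d * t + x_beta d * s
       - k_gamma d / 2%:R * ((l_alpha d * t + l_beta d * s) * s
                             - t * (m_alpha d * t + m_beta d * s))
       + k_gamma d * r)%R.

(** Certificate for an equation modulo a hypothesis: the multiplier u is supplied by hand, and
    [ring] or [field] checks the remaining identity. *)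
Lemma lincomb (R : pzRingType) (u P Q x y : R) :
  P = Q -> (x - y = u * (P - Q))%R -> x = y.
Proof. by move=> -> /eqP; rewrite subrr mulr0 subr_eq0 => /eqP. Qed.

Lemma lincomb2 (R : pzRingType) (u v P Q P' Q' x y : R) :
  P = Q -> P' = Q' -> (x - y = u * (P - Q) + v * (P' - Q'))%R -> x = y.
Proof. by move=> -> ->; rewrite !subrr !mulr0 addr0 => /eqP; rewrite subr_eq0 => /eqP. Qed.

Lemma lincomb3 (R : pzRingType) (u v w P Q P' Q' P'' Q'' x y : R) :
  P = Q -> P' = Q' -> P'' = Q'' ->
  (x - y = u * (P - Q) + v * (P' - Q') + w * (P'' - Q''))%R -> x = y.
Proof.
move=> -> -> ->; rewrite !subrr !mulr0 !addr0 => /eqP.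
by rewrite subr_eq0 => /eqP.
Qed.

Lemma additive_Fp (p : nat) (f : 'F_p -> 'F_p) :
  (forall t s, f (t + s) = f t + f s)%R -> forall t, (f t = f 1 * t)%R.
Proof.
move=> fD t; rewrite -(natr_Zp t); elim: (nat_of_ord t) => [|n IHn].
  by apply: (addrI (f 0%R)); rewrite -fD mulr0 !addr0.
by rewrite -natr1 fD IHn; ring.
Qed.

Lemma additive2_Fp (p : nat) (f : 'F_p -> 'F_p -> 'F_p) :
  (forall t s t' s', f (t + t') (s + s') = f t s + f t' s')%R ->
  forall t s, (f t s = f 1 0 * t + f 0 1 * s)%R.
Proof.
move=> fD t s.
rewrite -(@additive_Fp p (f^~ 0%R)); last by move=> x y; rewrite -fD addr0.
rewrite -(@additive_Fp p (f 0%R)); last by move=> x y; rewrite -fD addr0.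
by rewrite -fD addr0 add0r.
Qed.

Section RotaBaxterCoordinates.

Variables (p : nat) (gT : finGroupType) (S : 'F_p -> 'F_p -> 'F_p -> gT).
Hypotheses (p_pr : prime p) (p_odd : odd p) (coS : heis_coords S).

Let two_neq0 := Fp_two_neq0 p_pr p_odd.
Let SM := coordsM coS.

Lemma coords_eq t s r t' s' r' :
  t = t' -> s = s' -> r = r' -> S t s r = S t' s' r'.
Proof. by move=> -> -> ->. Qed.

Lemma coords_inverse : exists K : gT -> 'F_p * 'F_p * 'F_p,
  forall t s r, K (S t s r) = (t, s, r).
Proof.
exists (fun g => odflt (0, 0, 0)%R [pick u | S u.1.1 u.1.2 u.2 == g]) => t s r.
case: pickP => [[[t' s'] r'] /= /eqP/(coords_inj coS)[-> -> ->] //|].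
by move/(_ (t, s, r)); rewrite eqxx.
Qed.

Lemma coords1 : S 0%R 0%R 0%R = 1.
Proof.
apply: (mulIg (S 0%R 0%R 0%R)); rewrite SM mul1g.
by apply: coords_eq; field.
Qed.

Lemma coordsV t s r : (S t s r)^-1 = S (- t)%R (- s)%R (- r)%R.
Proof.
apply: (mulIg (S t s r)); rewrite mulVg SM -coords1.
by apply: coords_eq; field.
Qed.

Lemma sym_params_exists d : exists B : {ffun gT -> gT}, sym_params S d B.
Proof.
have [K SK] := coords_inverse.
pose f t s r := S (l_alpha d * t + l_beta d * s)%R (m_alpha d * t + m_beta d * s)%R
      (x_alpha d * t + x_beta d * s
       - k_gamma d / 2%:R * ((l_alpha d * t + l_beta d * s) * s
                             - t * (m_alpha d * t + m_beta d * s))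
       + k_gamma d * r)%R.
by exists [ffun g => f (K g).1.1 (K g).1.2 (K g).2] => t s r; rewrite ffunE SK.
Qed.

Lemma eq_sym_params d (B B' : {ffun gT -> gT}) :
  sym_params S d B -> sym_params S d B' -> B = B'.
Proof.
move=> dB dB'; apply/ffunP => g; have [t [s [r ->]]] := coords_onto coS g.
by rewrite dB dB'.
Qed.

Lemma sym_params_inj d d' (B : gT -> gT) :
  sym_params S d B -> sym_params S d' B -> d = d'.
Proof.
case: d d' => [la lb ma mb xa xb k] [la' lb' ma' mb' xa' xb' k'] dB dB'.
have E t s r := coords_inj coS (etrans (esym (dB t s r)) (dB' t s r)).
move: (E 1 0 0)%R (E 0 1 0)%R (E 0 0 1)%R => /= [e1 e2 e3] [e4 e5 e6] [_ _ e7].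
have ela : la = la' by apply: (lincomb (u := 1%R) e1); field.
have ema : ma = ma' by apply: (lincomb (u := 1%R) e2); field.
have elb : lb = lb' by apply: (lincomb (u := 1%R) e4); field.
have emb : mb = mb' by apply: (lincomb (u := 1%R) e5); field.
have ek : k = k' by apply: (lincomb (u := 1%R) e7); field.
move: e3 e6; rewrite ela ema elb emb ek => e3 e6; congr RBParams.
- by apply: (lincomb (u := 1%R) e3); field.
- by apply: (lincomb (u := 1%R) e6); field.
Qed.

(** The two sides of the Rota-Baxter identity agree on the plane, and their central coordinates
    differ by the defect of validity times w(v, v') / 2. *)
Lemma sym_params_rota_baxter d (B : {ffun gT -> gT}) :
  valid_params d -> sym_params S d B -> rota_baxter B.
Proof.
case: d => [la lb ma mb xa xb k] vd dB g h.
have [t [s [r ->]]] := coords_onto coS g.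
have [t' [s' [r' ->]]] := coords_onto coS h.
rewrite !dB coordsV !SM dB /=; move: vd; rewrite /valid_params /= => vd.
apply: coords_eq; [by field | by field | ].
apply: (lincomb (u := ((t * s' - t' * s) / 2%:R)%R) vd); by field.
Qed.

(** Conjugation by B(g) only multiplies h by a central element, which the last summand t1 s' - t' s1
    records. *)
Lemma rota_baxter_coords (B : {ffun gT -> gT}) t s r t1 s1 r1 t' s' r' :
  rota_baxter B -> B (S t s r) = S t1 s1 r1 ->
  S t1 s1 r1 * B (S t' s' r') =
  B (S (t + t') (s + s')
       (r + r' + (t * s' - t' * s) / 2%:R + (t1 * s' - t' * s1)))%R.
Proof.
move=> rbB Bg; have := rbB (S t s r) (S t' s' r'); rewrite Bg coordsV !SM => ->.
by congr (B _); apply: coords_eq; field.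
Qed.

(** For central h the conjugation disappears, so central factors split off by [BSr]. Once B is known
    to preserve the centre, the identity makes the plane coordinates additive and leaves a quadratic
    [xi] as the only nonlinear datum. *)
Lemma rota_baxter_sym_params (B : {ffun gT -> gT}) :
  rota_baxter B -> exists2 d, valid_params d & sym_params S d B.
Proof.
move=> rbB; have [K SK] := coords_inverse.
have KS g : g = S (K g).1.1 (K g).1.2 (K g).2.
  by have [t [s [r ->]]] := coords_onto coS g; rewrite SK.
have BSr t s r q : B (S t s (r + q)%R) = B (S t s r) * B (S 0%R 0%R q).
  rewrite [in RHS](KS (B (S t s r))) (rota_baxter_coords _ _ _ rbB (KS _)).
  by congr (B _); apply: coords_eq; field.
pose tau r := (K (B (S 0%R 0%R r))).1.1.
pose sig r := (K (B (S 0%R 0%R r))).1.2.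
pose rho r := (K (B (S 0%R 0%R r))).2.
have BZ r : B (S 0%R 0%R r) = S (tau r) (sig r) (rho r) by exact: KS.
have ZD r q := BSr 0%R 0%R r q.
have tauL r : (tau r = tau 1 * r)%R.
  apply: additive_Fp => x y; move: (ZD x y); rewrite !BZ SM.
  by case/(coords_inj coS).
have sigL r : (sig r = sig 1 * r)%R.
  apply: additive_Fp => x y; move: (ZD x y); rewrite !BZ SM.
  by case/(coords_inj coS).
have rhoL r : (rho r = rho 1 * r)%R.
  apply: additive_Fp => x y; move: (ZD x y); rewrite !BZ SM.
  case/(coords_inj coS) => _ _ ->.
  rewrite (tauL x) (tauL y) (sigL x) (sigL y); by field.
(* B(c) is central: otherwise commuting it past a suitable B(h) would put a
   noncentral power of B(c) into the centre. *)
have tsw (t s : 'F_p) (w := (tau 1 * s - t * sig 1)%R) :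
  (tau 1 * w = 0 /\ sig 1 * w = 0)%R.
  have := rota_baxter_coords t s 0%R rbB (BZ 1%R).
  rewrite (_ : (1 + _ + _ + _)%R = (0 + (1 + w))%R); last by rewrite /w; field.
  rewrite (add0r t) (add0r s) (BSr _ _ _ (1 + w)%R) BZ.
  rewrite (tauL (1 + w)%R) (sigL (1 + w)%R) [B _]KS !SM.
  case/(coords_inj coS) => e1 e2 _; split.
    by apply: (lincomb (u := (-1)%R) e1); ring.
  by apply: (lincomb (u := (-1)%R) e2); ring.
have tau1 : tau 1%R = 0%R.
  by have [/eqP+ _] := tsw 0%R 1%R; rewrite mul0r subr0 mulr1 mulf_eq0 orbb => /eqP.
have sig1 : sig 1%R = 0%R.
  have [_ /eqP] := tsw 1%R 0%R; rewrite mulr0 mul1r sub0r mulrN oppr_eq0.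
  by rewrite mulf_eq0 orbb => /eqP.
pose k := rho 1%R.
have BC r : B (S 0%R 0%R r) = S 0%R 0%R (k * r)%R.
  by rewrite BZ tauL sigL rhoL tau1 sig1 !mul0r.
pose f1 t s := (K (B (S t s 0%R))).1.1.
pose f2 t s := (K (B (S t s 0%R))).1.2.
pose xi t s := (K (B (S t s 0%R))).2.
have BE t s r : B (S t s r) = S (f1 t s) (f2 t s) (xi t s + k * r)%R.
  rewrite -{1}[r]add0r BSr BC [B (S t s 0%R)]KS SM -/(f1 t s) -/(f2 t s).
  by rewrite -/(xi t s); apply: coords_eq; field.
have fD t s t' s' := rota_baxter_coords t' s' 0%R rbB (BE t s 0%R).
pose la := f1 1%R 0%R; pose lb := f1 0%R 1%R.
pose ma := f2 1%R 0%R; pose mb := f2 0%R 1%R.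
have f1L t s : (f1 t s = la * t + lb * s)%R.
  apply: additive2_Fp => x y x' y'; move: (fD x y x' y'); rewrite !BE SM.
  by case/(coords_inj coS).
have f2L t s : (f2 t s = ma * t + mb * s)%R.
  apply: additive2_Fp => x y x' y'; move: (fD x y x' y'); rewrite !BE SM.
  by case/(coords_inj coS).
have xiD t s t' s' : (xi (t + t') (s + s') = xi t s + xi t' s' +
   (f1 t s * f2 t' s' - f1 t' s' * f2 t s) / 2%:R
   - k * ((t * s' - t' * s) / 2%:R + (f1 t s * s' - t' * f2 t s)))%R.
  move: (fD t s t' s'); rewrite !BE SM; case/(coords_inj coS) => _ _ e.
  by apply: (lincomb (u := (-1)%R) e); field.
(* The defect of additivity of xi is symmetric in its two arguments. *)
have vd : (la * mb - k * la = lb * ma + k * mb + k)%R.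
  have e1 := xiD 1%R 0%R 0%R 1%R; have := xiD 0%R 1%R 1%R 0%R.
  rewrite !(addr0, add0r) in e1 *; rewrite e1 !f1L !f2L => e.
  apply: (lincomb (u := 1%R) e); by field.
(* This removes from [xi] its quadratic part - k / 2 w(L v, v); by [vd] the remainder is
   additive. *)
pose q t s := (xi t s + k / 2%:R * (f1 t s * s - t * f2 t s))%R.
have qL t s : (q t s = q 1 0 * t + q 0 1 * s)%R.
  apply: additive2_Fp => x y x' y'.
  rewrite /q xiD !f1L !f2L.
  apply: (lincomb (u := ((x * y' - x' * y) / 2%:R)%R) vd); by field.
exists (RBParams la lb ma mb (q 1 0) (q 0 1) k)%R => // t s r /=.
rewrite BE -f1L -f2L; apply: coords_eq => //.
apply: (lincomb (u := 1%R) (qL t s)); rewrite /q; by field.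
Qed.

End RotaBaxterCoordinates.

(* With A = [a11, a12; a21, a22], an automorphism acts by
   (v, r) |-> (A v, det A r + y v); the equations say that it conjugates the
   operator with parameters d into the one with parameters d'. *)
Definition conj_eqs (F : fieldType) (la lb ma mb xa xb k : F)
    (la' lb' ma' mb' xa' xb' k' : F) (a11 a12 a21 a22 y1 y2 : F) : Prop :=
  (let D := a11 * a22 - a12 * a21 in
   [/\ D != 0, k' = k,
       [/\ a11 * la' + a12 * ma' = la * a11 + lb * a21,
           a11 * lb' + a12 * mb' = la * a12 + lb * a22,
           a21 * la' + a22 * ma' = ma * a11 + mb * a21 &
           a21 * lb' + a22 * mb' = ma * a12 + mb * a22],
       D * xa' + (y1 * la' + y2 * ma') = xa * a11 + xb * a21 + k * y1 &
       D * xb' + (y1 * lb' + y2 * mb') = xa * a12 + xb * a22 + k * y2])%R.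

Definition params_conj (p : nat) (d d' : rb_params p) : Prop :=
  let: RBParams la lb ma mb xa xb k := d in
  let: RBParams la' lb' ma' mb' xa' xb' k' := d' in
  exists a11 a12 a21 a22 y1 y2 : 'F_p,
    conj_eqs la lb ma mb xa xb k la' lb' ma' mb' xa' xb' k' a11 a12 a21 a22 y1 y2.

Definition params_tilde (p : nat) (d : rb_params p) : rb_params p :=
  let: RBParams la lb ma mb xa xb k := d in
  (RBParams (- 1 - la) (- lb) (- ma) (- 1 - mb) (- xa) (- xb) (- 1 - k))%R.

Lemma valid_params_tilde (p : nat) (d : rb_params p) :
  valid_params d -> valid_params (params_tilde d).
Proof.
case: d => [la lb ma mb xa xb k]; rewrite /valid_params /= => vd.
by apply: (lincomb (u := 1%R) vd); ring.
Qed.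

Lemma params_tildeK (p : nat) : involutive (@params_tilde p).
Proof. by case=> [la lb ma mb xa xb k] /=; congr RBParams; ring. Qed.

(** * Automorphisms and the tilde action on parameters *)

Section Automorphisms.

Variables (p : nat) (gT : finGroupType) (S : 'F_p -> 'F_p -> 'F_p -> gT).
Hypotheses (p_pr : prime p) (p_odd : odd p) (coS : heis_coords S).

Let two_neq0 := Fp_two_neq0 p_pr p_odd.
Let SM := coordsM coS.

Lemma sym_params_tilde d (B : {ffun gT -> gT}) :
  sym_params S d B -> sym_params S (params_tilde d) (rb_tilde B).
Proof.
case: d => [la lb ma mb xa xb k] dB t s r.
rewrite ffunE (coordsV p_pr p_odd coS) dB SM /=.
by apply: coords_eq; field.
Qed.

Lemma aut_of_coords (a11 a12 a21 a22 y1 y2 : 'F_p)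
    (D := (a11 * a22 - a12 * a21)%R) : (D != 0)%R ->
  exists2 phi : {perm gT}, phi \in Aut [set: gT] &
    forall t s r, phi (S t s r) =
      S (a11 * t + a12 * s)%R (a21 * t + a22 * s)%R
        (D * r + (y1 * t + y2 * s))%R.
Proof.
move=> D_neq0; have [K SK] := coords_inverse coS.
pose f g := let: (t, s, r) := K g in
  S (a11 * t + a12 * s)%R (a21 * t + a22 * s)%R (D * r + (y1 * t + y2 * s))%R.
have fS t s r : f (S t s r) =
  S (a11 * t + a12 * s)%R (a21 * t + a22 * s)%R (D * r + (y1 * t + y2 * s))%R.
  by rewrite /f SK.
have fM : {morph f : x y / x * y}.
  move=> g h; have [t [s [r ->]]] := coords_onto coS g.
  have [t' [s' [r' ->]]] := coords_onto coS h.
  by rewrite SM !fS SM; apply: coords_eq; rewrite /D; field.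
have f_inj : injective f.
  move=> g h; have [t [s [r ->]]] := coords_onto coS g.
  have [t' [s' [r' ->]]] := coords_onto coS h.
  rewrite !fS => /(coords_inj coS)[e1 e2 e3].
  have et : t = t'.
    apply: (mulfI D_neq0).
    by apply: (lincomb2 (u := a22) (v := (- a12)%R) e1 e2); rewrite /D; ring.
  have es : s = s'.
    apply: (mulfI D_neq0).
    by apply: (lincomb2 (u := (- a21)%R) (v := a11) e1 e2); rewrite /D; ring.
  congr S => //; apply: (mulfI D_neq0); move: e3; rewrite et es.
  exact: addIr.
exists (perm f_inj); last by move=> t s r; rewrite permE fS.
rewrite inE; apply/andP; split; first by apply/subsetP=> x; rewrite inE.
by apply/morphicP => x y _ _; rewrite !permE fM.
Qed.

Lemma aut_coords (phi : {perm gT}) : phi \in Aut [set: gT] ->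
  exists a11 a12 a21 a22 y1 y2 : 'F_p, (a11 * a22 - a12 * a21 != 0)%R /\
    forall t s r, phi (S t s r) =
      S (a11 * t + a12 * s)%R (a21 * t + a22 * s)%R
        ((a11 * a22 - a12 * a21) * r + (y1 * t + y2 * s))%R.
Proof.
rewrite inE => /andP[_ /morphicP phiM].
have {}phiM x y : phi (x * y) = phi x * phi y by apply: phiM; rewrite inE.
have [K SK] := coords_inverse coS.
have KS g : g = S (K g).1.1 (K g).1.2 (K g).2.
  by have [t [s [r ->]]] := coords_onto coS g; rewrite SK.
pose f1 t s r := (K (phi (S t s r))).1.1.
pose f2 t s r := (K (phi (S t s r))).1.2.
pose f3 t s r := (K (phi (S t s r))).2.
have phiE t s r : phi (S t s r) = S (f1 t s r) (f2 t s r) (f3 t s r) by exact: KS.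
have phiSM t s r t' s' r' : phi (S t s r * S t' s' r') =
    S (f1 t s r) (f2 t s r) (f3 t s r) * S (f1 t' s' r') (f2 t' s' r') (f3 t' s' r').
  by rewrite phiM !phiE.
have comm0 r t s q : (f1 0 0 r * f2 t s q = f1 t s q * f2 0 0 r)%R.
  have : S 0%R 0%R r * S t s q = S t s q * S 0%R 0%R r.
    by rewrite !SM; apply: coords_eq; field.
  move/(congr1 phi); rewrite !phiSM !SM => /(coords_inj coS)[_ _ e].
  by apply: (lincomb (u := 1%R) e); field.
(* The image of a central element commutes with everything, in particular with [S 0 1 0] and
   [S 1 0 0], reached through their preimages; this kills both of its plane coordinates. *)
have f0 r : f1 0%R 0%R r = 0%R /\ f2 0%R 0%R r = 0%R.
  have [t1 [s1 [q1 E1]]] := coords_onto coS ((phi^-1 : {perm gT}) (S 0%R 1%R 0%R)).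
  have [t2 [s2 [q2 E2]]] := coords_onto coS ((phi^-1 : {perm gT}) (S 1%R 0%R 0%R)).
  have := comm0 r t1 s1 q1; have := comm0 r t2 s2 q2.
  rewrite [f1 t1 _ _]/f1 [f2 t1 _ _]/f2 [f1 t2 _ _]/f1 [f2 t2 _ _]/f2.
  by rewrite -E1 -E2 !permKV !SK /= mulr0 mul0r mulr1 mul1r => <- ->.
have f12 t s r : f1 t s r = f1 t s 0%R /\ f2 t s r = f2 t s 0%R.
  have : S t s r = S t s 0%R * S 0%R 0%R r by rewrite SM; apply: coords_eq; field.
  move/(congr1 phi); rewrite phiSM phiE SM => /(coords_inj coS)[-> -> _].
  by rewrite (f0 r).1 (f0 r).2 !addr0.
have f1D t s t' s' : (f1 (t + t') (s + s') 0 = f1 t s 0 + f1 t' s' 0)%R.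
  rewrite -(f12 _ _ (0 + 0 + (t * s' - t' * s) / 2%:R)%R).1.
  by move: (phiSM t s 0%R t' s' 0%R); rewrite !SM phiE => /(coords_inj coS)[].
have f2D t s t' s' : (f2 (t + t') (s + s') 0 = f2 t s 0 + f2 t' s' 0)%R.
  rewrite -(f12 _ _ (0 + 0 + (t * s' - t' * s) / 2%:R)%R).2.
  by move: (phiSM t s 0%R t' s' 0%R); rewrite !SM phiE => /(coords_inj coS)[].
have f1L := additive2_Fp f1D; have f2L := additive2_Fp f2D.
pose a11 := f1 1%R 0%R 0%R; pose a12 := f1 0%R 1%R 0%R.
pose a21 := f2 1%R 0%R 0%R; pose a22 := f2 0%R 1%R 0%R.
have f3D t s r t' s' r' :
  (f3 (t + t') (s + s') (r + r' + (t * s' - t' * s) / 2%:R) =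
   f3 t s r + f3 t' s' r' +
   (f1 t s 0 * f2 t' s' 0 - f1 t' s' 0 * f2 t s 0) / 2%:R)%R.
  move: (phiSM t s r t' s' r'); rewrite !SM phiE => /(coords_inj coS)[_ _ ->].
  by rewrite !(f12 _ _ r).1 !(f12 _ _ r).2 !(f12 _ _ r').1 !(f12 _ _ r').2.
have f3C t s r : (f3 t s r = f3 t s 0 + f3 0 0 r)%R.
  move: (f3D t s 0 0 0 r)%R; rewrite (f0 0%R).1 (f0 0%R).2.
  rewrite !(mulr0, mul0r, oppr0, addr0, add0r) => ->.
  by [].
have f3Z r : (f3 0 0 r = f3 0 0 1 * r)%R.
  apply: (additive_Fp (f := f3 0%R 0%R)) => x y.
  move: (f3D 0 0 x 0 0 y)%R; rewrite (f0 0%R).1 (f0 0%R).2.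
  by rewrite !(mulr0, mul0r, oppr0, addr0, add0r) => ->.
pose D := (a11 * a22 - a12 * a21)%R.
have f3D0 t s t' s' : (f3 (t + t') (s + s') 0 +
    f3 0 0 1 * ((t * s' - t' * s) / 2%:R) = f3 t s 0 + f3 t' s' 0 +
    (f1 t s 0 * f2 t' s' 0 - f1 t' s' 0 * f2 t s 0) / 2%:R)%R.
  by rewrite -f3D !add0r -f3Z -f3C.
(* Adding the two basis vectors in both orders isolates the antisymmetric part, which shows that the
   centre is scaled by the determinant. *)
have f3Z1 : f3 0%R 0%R 1%R = D.
  have e1 := f3D0 1%R 0%R 0%R 1%R; have e2 := f3D0 0%R 1%R 1%R 0%R.
  rewrite !(add0r, addr0) in e1 e2.
  rewrite -/a11 -/a12 -/a21 -/a22 in e1 e2.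
  by apply: (lincomb2 (u := 1%R) (v := (-1)%R) e1 e2); rewrite /D; field.
have f3L t s : (f3 t s 0 = f3 1 0 0 * t + f3 0 1 0 * s)%R.
  apply: (additive2_Fp (f := fun t s => f3 t s 0%R)) => x y x' y'.
  have := f3D0 x y x' y'; rewrite f3Z1.
  rewrite (f1L x) (f1L x') (f2L x) (f2L x') -/a11 -/a12 -/a21 -/a22 => e.
  by apply: (lincomb (u := 1%R) e); rewrite /D; field.
exists a11, a12, a21, a22, (f3 1%R 0%R 0%R), (f3 0%R 1%R 0%R); split.
  rewrite -/D -f3Z1; apply/eqP => f3Z10.
  have : S 0%R 0%R 1%R = S 0%R 0%R 0%R.
    apply: (@perm_inj _ phi); rewrite !phiE (f0 1%R).1 (f0 1%R).2.
    by rewrite (f0 0%R).1 (f0 0%R).2 f3Z10 f3Z mulr0.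
  by case/(coords_inj coS) => _ _ /eqP; rewrite oner_eq0.
move=> t s r; rewrite phiE (f12 t s r).1 (f12 t s r).2 f3C f3Z f3Z1 f3L.
by rewrite f1L f2L; apply: coords_eq => //; rewrite /D; ring.
Qed.

Lemma params_conj_equiv d d' (B B' : {ffun gT -> gT}) :
  valid_params d -> valid_params d' -> params_conj d d' ->
  sym_params S d B -> sym_params S d' B' -> rb_equiv B B'.
Proof.
move=> vd vd' cdd' dB dB'; apply: rst_step; split.
- exact: sym_params_rota_baxter vd dB.
- exact: sym_params_rota_baxter vd' dB'.
left; case: d d' dB dB' cdd' {vd vd'} => [la lb ma mb xa xb k].
case=> [la' lb' ma' mb' xa' xb' k'] dB dB' /=.
case=> a11 [a12 [a21 [a22 [y1 [y2 [D0 ek [e1 e2 e3 e4] e5 e6]]]]]].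
have [phi phiA phiE] := aut_of_coords y1 y2 D0.
exists phi => //; apply/ffunP => g; have [t [s [r ->]]] := coords_onto coS g.
apply: (@perm_inj _ phi); rewrite ffunE permKV phiE dB dB' phiE /=.
have E1 : (a11 * (la' * t + lb' * s) + a12 * (ma' * t + mb' * s)
  = la * (a11 * t + a12 * s) + lb * (a21 * t + a22 * s))%R.
  by apply: (lincomb2 (u := t) (v := s) e1 e2); ring.
have E2 : (a21 * (la' * t + lb' * s) + a22 * (ma' * t + mb' * s)
  = ma * (a11 * t + a12 * s) + mb * (a21 * t + a22 * s))%R.
  by apply: (lincomb2 (u := t) (v := s) e3 e4); ring.
apply: coords_eq => //; rewrite -E1 -E2 ek.
by apply: (lincomb2 (u := t) (v := s) e5 e6); field.
Qed.

Lemma params_conj_of_aut d d' (phi : {perm gT}) (B : {ffun gT -> gT}) :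
  phi \in Aut [set: gT] ->
  sym_params S d B -> sym_params S d' (rb_conj phi B) -> params_conj d d'.
Proof.
move=> /aut_coords[a11 [a12 [a21 [a22 [y1 [y2 [D0 phiE]]]]]]].
case: d d' => [la lb ma mb xa xb k] [la' lb' ma' mb' xa' xb' k'] dB dB'.
have E t s r : B (phi (S t s r)) = phi (rb_conj phi B (S t s r)).
  by rewrite ffunE permKV.
move: (E 1 0 0)%R (E 0 1 0)%R (E 0 0 1)%R.
rewrite !phiE !dB !dB' !phiE /=.
case/(coords_inj coS) => e1 e3 e5 /(coords_inj coS)[e2 e4 e6].
case/(coords_inj coS) => _ _ e7.
have ek : k' = k.
  by apply: (mulfI D0); apply: (lincomb (u := (-1)%R) e7); field.
exists a11, a12, a21, a22, y1, y2; rewrite ek in e5 e6 *; split=> //; first split.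
- by apply: (lincomb (u := (-1)%R) e1); ring.
- by apply: (lincomb (u := (-1)%R) e2); ring.
- by apply: (lincomb (u := (-1)%R) e3); ring.
- by apply: (lincomb (u := (-1)%R) e4); ring.
(* The multiples of [e1] and [e3] cancel the quadratic parts through w(A L' v, A v) = D w(L' v, v)
   at the first basis vector. *)
- apply: (lincomb3 (u := (-1)%R) (v := (- k / 2%:R * a21)%R) (w := (k / 2%:R * a11)%R) e5 e1 e3).
  by field.
- apply: (lincomb3 (u := (-1)%R) (v := (- k / 2%:R * a22)%R) (w := (k / 2%:R * a12)%R) e6 e2 e4).
  by field.
Qed.

End Automorphisms.

(** * Invariants of conjugacy *)

Definition params_trace (p : nat) (d : rb_params p) : 'F_p :=
  (l_alpha d + m_beta d)%R.

Definition params_scalar (p : nat) (d : rb_params p) : bool :=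
  [&& l_beta d == 0, m_alpha d == 0 & l_alpha d == m_beta d]%R.

Definition params_range (p : nat) (d : rb_params p) : bool :=
  [exists z : 'F_p * 'F_p,
    (x_alpha d == k_gamma d * z.1 - (z.1 * l_alpha d + z.2 * m_alpha d)) &&
    (x_beta d == k_gamma d * z.2 - (z.1 * l_beta d + z.2 * m_beta d))]%R.

Definition params_key (p : nat) (d : rb_params p) : 'F_p * 'F_p * bool * bool :=
  (k_gamma d, params_trace d, params_scalar d, params_range d).

Lemma params_rangeP (p : nat) (d : rb_params p) :
  reflect (exists z1 z2 : 'F_p,
    x_alpha d = (k_gamma d * z1 - (z1 * l_alpha d + z2 * m_alpha d))%R /\
    x_beta d = (k_gamma d * z2 - (z1 * l_beta d + z2 * m_beta d))%R)
  (params_range d).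
Proof.
apply: (iffP existsP) => [[[z1 z2] /= /andP[/eqP e1 /eqP e2]]|[z1 [z2 [e1 e2]]]].
  by exists z1, z2.
by exists (z1, z2); rewrite /= -e1 -e2 !eqxx.
Qed.

(** The new coefficients are those of the inverse automorphism, A^-1 and - y A^-1 / D. *)
Lemma conj_eqs_sym (F : fieldType) (la lb ma mb xa xb k : F)
    (la' lb' ma' mb' xa' xb' k' : F) (a11 a12 a21 a22 y1 y2 : F)
    (D := (a11 * a22 - a12 * a21)%R) :
  conj_eqs la lb ma mb xa xb k la' lb' ma' mb' xa' xb' k' a11 a12 a21 a22 y1 y2 ->
  conj_eqs la' lb' ma' mb' xa' xb' k' la lb ma mb xa xb k
    (a22 / D)%R (- a12 / D)%R (- a21 / D)%R (a11 / D)%R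
    (- (y1 * a22 - y2 * a21) / D / D)%R (- (y2 * a11 - y1 * a12) / D / D)%R.
Proof.
case=> D0 -> [e1 e2 e3 e4] e5 e6.
have E1 : (la' = (a22 * (la * a11 + lb * a21) - a12 * (ma * a11 + mb * a21))
                 / (a11 * a22 - a12 * a21))%R.
  by rewrite -e1 -e3; field.
have E2 : (lb' = (a22 * (la * a12 + lb * a22) - a12 * (ma * a12 + mb * a22))
                 / (a11 * a22 - a12 * a21))%R.
  by rewrite -e2 -e4; field.
have E3 : (ma' = (a11 * (ma * a11 + mb * a21) - a21 * (la * a11 + lb * a21))
                 / (a11 * a22 - a12 * a21))%R.
  by rewrite -e1 -e3; field.
have E4 : (mb' = (a11 * (ma * a12 + mb * a22) - a21 * (la * a12 + lb * a22))
                 / (a11 * a22 - a12 * a21))%R.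
  by rewrite -e2 -e4; field.
have E5 : (xa' = (xa * a11 + xb * a21 + k * y1 - (y1 * la' + y2 * ma'))
                 / (a11 * a22 - a12 * a21))%R.
  by rewrite -e5; field.
have E6 : (xb' = (xa * a12 + xb * a22 + k * y2 - (y1 * lb' + y2 * mb'))
                 / (a11 * a22 - a12 * a21))%R.
  by rewrite -e6; field.
have DE : (a22 / D * (a11 / D) - - a12 / D * (- a21 / D) = D^-1)%R.
  by rewrite /D; field.
rewrite /conj_eqs DE E5 E6 E1 E2 E3 E4.
split=> //; [by rewrite invr_eq0 | split; by rewrite /D; field | by rewrite /D; field | by rewrite /D; field].
Qed.

(** Since L A = A L', substituting x = z (k - L) into D x' + y L' = x A + k y gives D x' = (z A +
    y)(k - L'). *)
Lemma conj_eqs_range (F : fieldType) (la lb ma mb xa xb k : F)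
    (la' lb' ma' mb' xa' xb' k' : F) (a11 a12 a21 a22 y1 y2 z1 z2 : F)
    (D := (a11 * a22 - a12 * a21)%R) :
  conj_eqs la lb ma mb xa xb k la' lb' ma' mb' xa' xb' k' a11 a12 a21 a22 y1 y2 ->
  (xa = k * z1 - (z1 * la + z2 * ma) -> xb = k * z2 - (z1 * lb + z2 * mb) ->
  let z1' := (z1 * a11 + z2 * a21 + y1) / D in
  let z2' := (z1 * a12 + z2 * a22 + y2) / D in
  xa' = k' * z1' - (z1' * la' + z2' * ma') /\
  xb' = k' * z2' - (z1' * lb' + z2' * mb'))%R.
Proof.
case=> D0 -> [e1 e2 e3 e4] e5 e6 f1 f2 /=.
split; apply: (mulfI D0).
  apply: (lincomb3 (u := 1%R) (v := z1) (w := z2) e5 e1 e3).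
  by rewrite f1 f2 /D; field.
apply: (lincomb3 (u := 1%R) (v := z1) (w := z2) e6 e2 e4).
by rewrite f1 f2 /D; field.
Qed.

(** Cramer's rule: z is x times the adjugate of k - L, divided by the determinant, which validity
    turns into k (k + 1). *)
Lemma valid_range (F : fieldType) (la lb ma mb xa xb k : F)
    (z1 := ((xa * (k - mb) + xb * ma) / (k * (k + 1)))%R)
    (z2 := ((xa * lb + xb * (k - la)) / (k * (k + 1)))%R) :
  (la * mb - k * la = lb * ma + k * mb + k)%R -> (k * (k + 1) != 0)%R ->
  (xa = k * z1 - (z1 * la + z2 * ma) /\ xb = k * z2 - (z1 * lb + z2 * mb))%R.
Proof.
move=> vd D0; have [k0 k1] : (k != 0)%R /\ (k + 1 != 0)%R.
  by apply/andP; rewrite -negb_or -mulf_eq0.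
split; apply: (mulfI D0).
  by apply: (lincomb (u := (- xa)%R) vd); rewrite /z1 /z2; field; rewrite ?k0 ?k1.
by apply: (lincomb (u := (- xb)%R) vd); rewrite /z1 /z2; field; rewrite ?k0 ?k1.
Qed.

Section ConjugateParameters.

Variable p : nat.
Implicit Types d : rb_params p.

Lemma params_conj_sym d d' : params_conj d d' -> params_conj d' d.
Proof.
case: d d' => [la lb ma mb xa xb k] [la' lb' ma' mb' xa' xb' k'] /=.
case=> a11 [a12 [a21 [a22 [y1 [y2 /conj_eqs_sym e]]]]].
by do 6!eexists; exact: e.
Qed.

Lemma params_conj_key d d' : params_conj d d' -> params_key d = params_key d'.
Proof.
move=> cdd'; rewrite /params_key.
have [ek et] : k_gamma d = k_gamma d' /\ params_trace d = params_trace d'.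
  case: d d' cdd' => [la lb ma mb xa xb k] [la' lb' ma' mb' xa' xb' k'] /=.
  case=> a11 [a12 [a21 [a22 [y1 [y2 [D0 -> [e1 e2 e3 e4] _ _]]]]]].
  split=> //; apply: (mulfI D0); rewrite /params_trace /=.
  rewrite [LHS](_ : _ = a22 * (la * a11 + lb * a21) - a12 * (ma * a11 + mb * a21)
    - a21 * (la * a12 + lb * a22) + a11 * (ma * a12 + mb * a22))%R; last by ring.
  by rewrite -e1 -e2 -e3 -e4; ring.
have es d1 d2 : params_conj d1 d2 -> params_scalar d1 -> params_scalar d2.
  case: d1 d2 => [la lb ma mb xa xb k] [la' lb' ma' mb' xa' xb' k'] /=.
  case=> a11 [a12 [a21 [a22 [y1 [y2 [D0 _ [e1 e2 e3 e4] _ _]]]]]].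
  rewrite /params_scalar /= => /and3P[/eqP z1 /eqP z2 /eqP z3].
  rewrite z1 z2 z3 !mul0r ?addr0 ?add0r in e1 e2 e3 e4.
  have E1 : (lb' = 0)%R.
    by apply: (mulfI D0); apply: (lincomb2 (u := a22) (v := (- a12)%R) e2 e4); ring.
  have E2 : (ma' = 0)%R.
    by apply: (mulfI D0); apply: (lincomb2 (u := (-a21)%R) (v := a11) e1 e3); ring.
  have E3 : (la' = mb)%R.
    by apply: (mulfI D0); apply: (lincomb2 (u := a22) (v := (-a12)%R) e1 e3); ring.
  have E4 : (mb' = mb)%R.
    by apply: (mulfI D0); apply: (lincomb2 (u := (-a21)%R) (v := a11) e2 e4); ring.
  by rewrite E1 E2 E3 E4 !eqxx.
have er d1 d2 : params_conj d1 d2 -> params_range d1 -> params_range d2.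
  move=> cc /params_rangeP; case: d1 d2 cc => [la lb ma mb xa xb k].
  case=> [la' lb' ma' mb' xa' xb' k'] /=.
  case=> a11 [a12 [a21 [a22 [y1 [y2 e]]]]] [z1 [z2 [f1 f2]]].
  by apply/params_rangeP; do 2!eexists; apply: conj_eqs_range e f1 f2.
have cd'd := params_conj_sym cdd'.
congr (_, _, _, _) => //; apply/idP/idP.
- exact: es cdd'.
- exact: es cd'd.
- exact: er cdd'.
- exact: er cd'd.
Qed.

(** Tilde negates both x and k - L, so the same z witnesses membership in the row space. *)
Lemma params_tilde_key d :
  params_key (params_tilde d) = (- 1 - k_gamma d, - 2%:R - params_trace d,
                                 params_scalar d, params_range d)%R.
Proof.
rewrite /params_key; congr (_, _, _, _).
- by case: d.
- by case: d => * /=; rewrite /params_trace /=; ring.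
- case: d => [la lb ma mb xa xb k]; rewrite /params_scalar /= !oppr_eq0.
  by rewrite (inj_eq (addrI _)) eqr_opp.
suff tl (e : rb_params p) : params_range e -> params_range (params_tilde e).
  by apply/idP/idP => [/tl|/tl //]; rewrite params_tildeK.
case: e => [la lb ma mb xa xb k] /params_rangeP /=.
case=> z1 [z2 [-> ->]].
by apply/params_rangeP; exists z1, z2; split=> /=; ring.
Qed.

(* The determinant of k - L is k (k + 1). *)
Lemma params_range_unit d : valid_params d -> k_gamma d != 0%R ->
  k_gamma d != (-1)%R -> params_range d.
Proof.
case: d => [la lb ma mb xa xb k]; rewrite /valid_params /= => vd k0 k1.
have D0 : (k * (k + 1) != 0)%R by rewrite mulf_neq0 // addr_eq0.
by apply/params_rangeP; do 2!eexists; apply: valid_range.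
Qed.

End ConjugateParameters.

(** * Normal forms under conjugation *)

Lemma params_keyP (p : nat) (d d' : rb_params p) :
  params_key d = params_key d' ->
  [/\ k_gamma d = k_gamma d', params_trace d = params_trace d',
      params_scalar d = params_scalar d' & params_range d = params_range d'].
Proof.
by move=> e; split; have := e; [move/(congr1 (fun x => x.1.1.1))
  | move/(congr1 (fun x => x.1.1.2)) | move/(congr1 (fun x => x.1.2))
  | move/(congr1 snd)].
Qed.

(** The expression is det (m w - L w | w) with m the trace, the quadratic form ma w1^2 + (mb - la)
    w1 w2 - lb w2^2. If it vanishes at (0, 1), (1, 0) and (1, 1), then L is scalar. *)
Lemma nonscalar_cyclic_vector (p : nat) (la lb ma mb : 'F_p) :
  ~~ [&& lb == 0, ma == 0 & la == mb]%R ->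
  exists w1 w2 : 'F_p,
    ((mb * w1 - lb * w2) * w2 - w1 * (la * w2 - ma * w1) != 0)%R.
Proof.
have [-> | lb0 _] /= := eqVneq lb 0%R; last first.
  by exists 0%R, 1%R; rewrite !(mul0r, mulr0, mulr1, sub0r, subr0) oppr_eq0.
have [-> /= la_mb | ma0 _] := eqVneq ma 0%R; last first.
  by exists 1%R, 0%R; rewrite !(mul0r, mulr0, mulr1, sub0r, subr0, mul1r, opprK).
exists 1%R, 1%R; rewrite !(mul0r, mulr1, mul1r, subr0) subr_eq0.
by rewrite eq_sym.
Qed.

(* A = (m w - L w | w) for a cyclic vector w, where m is the trace of L *)
Lemma params_conj_companion (p : nat) (d : rb_params p) :
  valid_params d -> ~~ params_scalar d -> exists xa xb,
  params_conj d (RBParams 0 (-1) (k_gamma d * (params_trace d + 1))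
                   (params_trace d) xa xb (k_gamma d))%R.
Proof.
case: d => [la lb ma mb xa xb k]; rewrite /valid_params /params_trace /= => vd.
case/nonscalar_cyclic_vector => w1 [w2 D0]; rewrite /= in D0.
pose a11 := (mb * w1 - lb * w2)%R; pose a21 := (la * w2 - ma * w1)%R.
pose D := (a11 * w2 - w1 * a21)%R.
exists ((xa * a11 + xb * a21) / D)%R, ((xa * w1 + xb * w2) / D)%R.
exists a11, w1, a21, w2, 0%R, 0%R; split=> //; first split.
(* By Cayley-Hamilton L (m w - L w) = (det L) w, and validity rewrites det L as k (m + 1). *)
- by apply: (lincomb (u := (- w1)%R) vd); rewrite /a11 /a21; ring.
- by rewrite /a11; ring.
- by apply: (lincomb (u := (- w2)%R) vd); rewrite /a11 /a21; ring.
- by rewrite /a21; ring.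
- by rewrite -/D; field.
- by rewrite -/D; field.
Qed.

(** With A = 1, the choice of y1 clears [x_beta] and leaves xa - k xb - k (k + 1) y2 in [x_alpha];
    y2 can clear this as soon as k (k + 1) is invertible. *)
Lemma params_conj_shift (p : nat) (m xa xb k : 'F_p) : exists2 xi : 'F_p,
  params_conj (RBParams 0 (-1) (k * (m + 1)) m xa xb k)%R
              (RBParams 0 (-1) (k * (m + 1)) m xi 0 k)%R &
  (k != 0 -> k != -1 -> xi = 0)%R.
Proof.
pose y2 := (if k * (k + 1) == 0 then 0 else (xa - k * xb) / (k * (k + 1)))%R.
exists (xa - k * xb - k * (k + 1) * y2)%R; last first.
  move=> k0; rewrite -addr_eq0 => k1.
  by rewrite /y2 (negPf (mulf_neq0 k0 k1)); field; rewrite ?k0 ?k1.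
exists 1%R, 0%R, 0%R, 1%R, ((m - k) * y2 - xb)%R, y2.
by split; [by rewrite mul1r mul0r subr0 oner_eq0 | | split | | ]; ring.
Qed.

(** A homothety commutes with L, and it divides x by its ratio because D is the square of the
    ratio. *)
Lemma params_conj_scale (p : nat) (m xi : 'F_p) : (xi != 0)%R ->
  params_conj (RBParams 0 (-1) (0 * (m + 1)) m xi 0 0)%R
              (RBParams 0 (-1) (0 * (m + 1)) m 1 0 0)%R.
Proof.
move=> xi0; exists xi, 0%R, 0%R, xi, 0%R, 0%R.
by split; [by rewrite mul0r subr0 mulf_neq0 | | split | | ]; ring.
Qed.

(** For scalar L = l, validity excludes l = k unless k (k + 1) = 0; so k - L is invertible and a
    suitable y clears x. *)
Lemma params_conj_scalar (p : nat) (d : rb_params p) :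
  valid_params d -> params_scalar d -> k_gamma d != 0%R -> k_gamma d != (-1)%R ->
  params_conj d (RBParams (l_alpha d) 0 0 (l_alpha d) 0 0 (k_gamma d))%R.
Proof.
case: d => [la lb ma mb xa xb k]; rewrite /valid_params /params_scalar /=.
move=> vd /and3P[/eqP z1 /eqP z2 /eqP z3]; rewrite {}z1 {}z2 -{mb}z3 in vd *.
move=> k0 k1; have D0 : (la - k != 0)%R.
  rewrite subr_eq0; apply: contraNneq k1 => lak; rewrite lak in vd.
  rewrite -addr_eq0 -(mulrI_eq0 _ (mulfI k0)); apply/eqP.
  by apply: (lincomb (u := (-1)%R) vd); ring.
exists 1%R, 0%R, 0%R, 1%R, (xa / (la - k))%R, (xb / (la - k))%R.
by split; [by rewrite mul1r mul0r subr0 oner_eq0 | | split; ring | field | field].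
Qed.

Lemma params_conj_zero (p : nat) (xa xb : 'F_p) : (xa != 0)%R || (xb != 0)%R ->
  params_conj (RBParams 0 0 0 0 xa xb 0)%R (RBParams 0 0 0 0 1 0 0)%R.
Proof.
have [-> /= xb0 | xa0 _] := eqVneq xa 0%R.
  exists 0%R, (- xb)%R, 1%R, 0%R, 0%R, 0%R; split; [ | | split | | ]; try by ring.
  by rewrite mul0r sub0r mulr1 opprK.
exists 1%R, (- xb)%R, 0%R, xa, 0%R, 0%R; split; [ | | split | | ]; try by ring.
by rewrite mulr0 subr0 mul1r.
Qed.

(** * Equivalence of operators with equal invariants *)

Section ParameterEquivalence.

Variables (p : nat) (gT : finGroupType) (S : 'F_p -> 'F_p -> 'F_p -> gT).
Hypotheses (p_pr : prime p) (p_odd : odd p) (coS : heis_coords S).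
Implicit Types d : rb_params p.

Definition params_equiv d d' : Prop := forall B B' : {ffun gT -> gT},
  sym_params S d B -> sym_params S d' B' -> rb_equiv B B'.

Lemma params_equiv_conj d d' : valid_params d -> valid_params d' ->
  params_conj d d' -> params_equiv d d'.
Proof. by move=> vd vd' cdd' B B'; apply: params_conj_equiv vd vd' cdd'. Qed.

Lemma params_equiv_sym d d' : params_equiv d d' -> params_equiv d' d.
Proof. by move=> edd' B B' dB dB'; apply: rst_sym; apply: edd'. Qed.

Lemma params_equiv_trans d2 d1 d3 :
  params_equiv d1 d2 -> params_equiv d2 d3 -> params_equiv d1 d3.
Proof.
move=> e12 e23 B1 B3 dB1 dB3; have [B2 dB2] := sym_params_exists coS d2.
by apply: rst_trans (e12 _ _ dB1 dB2) (e23 _ _ dB2 dB3).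
Qed.

Lemma params_equiv_tilde d : valid_params d -> params_equiv d (params_tilde d).
Proof.
move=> vd B B' dB dB'; have tB := sym_params_tilde p_pr p_odd coS dB.
rewrite (eq_sym_params coS dB' tB); apply: rst_step; split.
- exact: sym_params_rota_baxter vd dB.
- exact: sym_params_rota_baxter (valid_params_tilde vd) tB.
- by right.
Qed.

(** At k = 0 the row space of k - L for the companion form consists of vectors with first entry 0.
    Hence the entry left by [params_conj_shift] vanishes exactly when x is in range, and otherwise
    it is scaled to 1. *)
Lemma nonscalar_params_equiv d : valid_params d -> ~~ params_scalar d ->
  k_gamma d != (-1)%R ->
  params_equiv d (RBParams 0 (-1) (k_gamma d * (params_trace d + 1))
    (params_trace d) (if params_range d then 0 else 1) 0 (k_gamma d))%R.
Proof.
move=> vd ns k1; have [xa [xb c1]] := params_conj_companion vd ns.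
have [xi c2 xi0] := params_conj_shift (params_trace d) xa xb (k_gamma d).
set k := k_gamma d in k1 c1 c2 xi0 *; set m := params_trace d in c1 c2 xi0 *.
have vc x1 x2 : valid_params (RBParams 0 (-1) (k * (m + 1)) m x1 x2 k)%R.
  by rewrite /valid_params /=; ring.
apply: params_equiv_trans (params_equiv_conj vd (vc _ _) c1) _.
apply: params_equiv_trans (params_equiv_conj (vc _ _) (vc _ _) c2) _.
have eqr : params_range d =
    params_range (RBParams 0 (-1) (k * (m + 1)) m xi 0 k)%R.
  by case/params_keyP: (etrans (params_conj_key c1) (params_conj_key c2)).
have [xi_eq0|xi_neq0] := eqVneq xi 0%R.
  suff -> : params_range d by rewrite xi_eq0; apply: params_equiv_conj => //;
    exists 1%R, 0%R, 0%R, 1%R, 0%R, 0%R;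
    split; [by rewrite mul1r mul0r subr0 oner_eq0 | | split | | ]; ring.
  rewrite eqr; apply/params_rangeP; exists 0%R, 0%R => /=; split=> //.
  - by rewrite xi_eq0; ring.
  - by ring.
have k0 : k = 0%R by apply/eqP; apply: contraNT xi_neq0 => k0; rewrite xi0.
suff /negPf-> : ~~ params_range d.
  apply: params_equiv_conj => //; rewrite k0; exact: params_conj_scale.
rewrite eqr; apply: contraNN xi_neq0 => /params_rangeP[z1 [z2 /= [-> _]]].
by rewrite k0; apply/eqP; ring.
Qed.

Lemma nonscalar_key_equiv d d' : valid_params d -> valid_params d' ->
  ~~ params_scalar d -> k_gamma d != (-1)%R -> params_key d = params_key d' ->
  params_equiv d d'.
Proof.
move=> vd vd' ns k1 /params_keyP[ek et es er]; have e := nonscalar_params_equiv vd ns k1.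
rewrite ek et er in e; rewrite ek in k1; rewrite es in ns.
exact: params_equiv_trans e (params_equiv_sym (nonscalar_params_equiv vd' ns k1)).
Qed.

Lemma scalar_key_equiv d d' : valid_params d -> valid_params d' ->
  params_scalar d -> k_gamma d != 0%R -> k_gamma d != (-1)%R ->
  params_key d = params_key d' -> params_equiv d d'.
Proof.
move=> vd vd' sd k0 k1 /params_keyP[ek et es er].
have vc (e : rb_params p) : valid_params e -> params_scalar e ->
   valid_params (RBParams (l_alpha e) 0 0 (l_alpha e) 0 0 (k_gamma e))%R.
  case: e => [la lb ma mb xa xb k]; rewrite /valid_params /params_scalar /=.
  by move=> ve /and3P[/eqP z1 /eqP z2 /eqP z3]; rewrite z1 z2 z3 in ve *.
have e1 := params_equiv_conj vd (vc _ vd sd) (params_conj_scalar vd sd k0 k1).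
rewrite es in sd; have ela : l_alpha d = l_alpha d'.
  have sd0 : params_scalar d by rewrite es.
  case/and3P: sd0 sd => _ _ /eqP e1' /and3P[_ _ /eqP e2'].
  apply: (mulfI (Fp_two_neq0 p_pr p_odd)); move: et.
  by rewrite /params_trace -e1' -e2' -!mulr2n !mulr_natl.
rewrite ek ela in e1 k0 k1.
apply: params_equiv_trans e1 (params_equiv_sym _).
exact: params_equiv_conj vd' (vc _ vd' sd) (params_conj_scalar vd' sd k0 k1).
Qed.

Lemma zero_params_equiv (xa xb : 'F_p) : (xa != 0)%R || (xb != 0)%R ->
  params_equiv (RBParams 0 0 0 0 xa xb 0)%R (RBParams 0 0 0 0 1 0 0)%R.
Proof.
move=> x0; apply: params_equiv_conj; last exact: params_conj_zero.
  by rewrite /valid_params /=; ring.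
by rewrite /valid_params /=; ring.
Qed.

End ParameterEquivalence.

(* Passing from the coordinates b^s a^t c^r to the symmetric ones only changes
   the linear part of the central coordinate. *)
Definition chi_sym (p : nat) (chi : rb_params p) : rb_params p :=
  let: RBParams la lb ma mb xa xb k := chi in
  (RBParams la lb ma mb (xa - ma * (la + k) / 2%:R) (xb - lb * (mb - k) / 2%:R) k)%R.

Lemma valid_chi_sym (p : nat) (chi : rb_params p) :
  valid_params (chi_sym chi) <-> valid_params chi.
Proof. by case: chi. Qed.

Lemma has_chi_sym (p : nat) (gT : finGroupType) (a b c : gT) (B : {ffun gT -> gT})
    (chi : rb_params p) : prime p -> odd p -> valid_params chi ->
  sym_params (sym_elt a b c) (chi_sym chi) B -> has_chi a b c B chi.
Proof.
move=> p_pr p_odd vd dB s t r; have two_neq0 := Fp_two_neq0 p_pr p_odd.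
have := dB t s (r - t * s / 2%:R)%R; rewrite /sym_elt subrK => ->.
case: chi vd {dB} => [la lb ma mb xa xb k]; rewrite /valid_params /= => vd.
congr (heis_elt a b c _ _ _).
by apply: (lincomb (u := (t * s / 2%:R)%R) vd); field.
Qed.

Lemma sym_has_chi (p : nat) (gT : finGroupType) (a b c : gT) (B : {ffun gT -> gT})
    (chi : rb_params p) : prime p -> odd p -> valid_params chi ->
  has_chi a b c B chi -> sym_params (sym_elt a b c) (chi_sym chi) B.
Proof.
move=> p_pr p_odd vd dB t s r; have two_neq0 := Fp_two_neq0 p_pr p_odd.
rewrite /sym_elt dB; case: chi vd {dB} => [la lb ma mb xa xb k].
rewrite /valid_params /= => vd.
congr (heis_elt a b c _ _ _).
by apply: (lincomb (u := (- (t * s / 2%:R))%R) vd); field.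
Qed.

Lemma ltn_half_reflect n q k : q.*2.+1 = n -> (k < n)%N -> k <> q ->
  (n - 1 - k < q)%N = ~~ (k < q)%N.
Proof. by move=> <- k_n k_q; apply/idP/idP; lia. Qed.

Lemma reflect_lower_half n q k : q.*2.+1 = n -> (k < n)%N -> k != (n - 1)%N ->
  (q <= k)%N -> k <> q -> (1 <= n - 1 - k < q)%N.
Proof. by lia. Qed.

(** For scalar L, k is m^2 / (2m + 1); tilde sends m to -1-m, and this must agree with k |->
    -1-k. *)
Lemma scalar_key_reflect (F : fieldType) (m : F) : (2%:R * m + 1 != 0 ->
  (- 1 - m) ^+ 2 / (2%:R * (- 1 - m) + 1) = - 1 - m ^+ 2 / (2%:R * m + 1))%R.
Proof.
move=> D0; have -> : (2%:R * (- 1 - m) + 1 = - (2%:R * m + 1))%R by ring.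
by rewrite invrN mulrN; field.
Qed.

(** * Labels of the list and their invariants *)

Section Representatives.

Variable p : nat.
Hypotheses (p_pr : prime p) (p_odd : odd p).
Implicit Types L : rb_label p.

Let two_neq0 := Fp_two_neq0 p_pr p_odd.
Let h : nat := ((p - 1) %/ 2)%N.

Lemma Fp_val_lt (x : 'F_p) : (x < p)%N.
Proof. by apply: leq_trans (ltn_ord x) _; rewrite Fp_cast. Qed.

Lemma Fp_nat_val n : (n < p)%N -> nat_of_ord (n%:R : 'F_p)%R = n.
Proof. by move=> n_p; rewrite val_Fp_nat // modn_small. Qed.

Lemma Fp_p_eq0 : (p%:R : 'F_p)%R = 0%R.
Proof. by apply: ord_inj; rewrite val_Fp_nat // modnn. Qed.

Lemma Fp_val_reflect (x : 'F_p) : nat_of_ord (- 1 - x)%R = (p - 1 - x)%N.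
Proof.
have x_p := Fp_val_lt x; have p1 := prime_gt1 p_pr.
rewrite -[RHS]Fp_nat_val; last by lia.
congr nat_of_ord; rewrite -[in LHS](natr_Zp x).
apply/eqP; rewrite eq_sym -subr_eq0 !natrB ?Fp_p_eq0; last by lia.
  by apply/eqP; ring.
by lia.
Qed.

Lemma half_p : (h.*2.+1)%N = p.
Proof. by have := odd_double_half p; rewrite p_odd /h divn2; lia. Qed.

Lemma Fp_half : (h%:R + h%:R = -1 :> 'F_p)%R.
Proof.
apply/eqP; rewrite -addr_eq0 -natrD natr1; apply/eqP.
by rewrite addnn half_p Fp_p_eq0.
Qed.

(** Canonical choice between the two points exchanged by x |-> u - x: u = -1 serves k and the scalar
    l = m / 2, u = -2 serves the trace. *)
Definition small_rep (u x : 'F_p) : nat := minn x (nat_of_ord (u - x)%R).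

Lemma small_rep_reflect u x : small_rep u (u - x)%R = small_rep u x.
Proof. by rewrite /small_rep minnC (_ : u - (u - x) = x)%R //; ring. Qed.

Definition lower_half (x : 'F_p) : bool := (x < h)%N.

(** Total on all keys, so that invariance under tilde holds without validity. The trivial operators
    also receive [LB4], which is harmless because labels are compared only for listed operators. In
    [LB1] the trace follows whichever of k and -1-k is retained. *)
Definition key_label (key : 'F_p * 'F_p * bool * bool) : rb_label p :=
  let: (k, m, s, x) := key in
  if (k == 0)%R || (k == -1)%R then
    let m0 := (if k == 0 then m else - 2%:R - m)%R in
    if s then LB4 else if (m0 == 0)%R then (if x then LB6 else LB5)
    else if x then LB8 m0 else LB7 m0
  else if s then LB3 p (small_rep (-1)%R (m / 2%:R)%R)
  else if (k == h%:R)%R then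
    if (m == -1)%R then LO2
    else LO1 p (small_rep (- 2%:R)%R m)
  else if (m == -1)%R then LB2 p (small_rep (-1)%R k)
  else LB1 (small_rep (-1)%R k) (if lower_half k then m else (- 2%:R - m)%R).

Lemma key_label_tilde k m s x :
  key_label (- 1 - k, - 2%:R - m, s, x)%R = key_label (k, m, s, x).
Proof.
have m_inv : (- 2%:R - (- 2%:R - m) = m)%R by ring.
have m1 : ((- 2%:R - m == -1) = (m == -1))%R.
  by apply/eqP/eqP => e; apply: (lincomb (u := (-1)%R) e); ring.
have k0 : ((- 1 - k == 0) = (k == -1))%R.
  by apply/eqP/eqP => e; apply: (lincomb (u := (-1)%R) e); ring.
have k1 : ((- 1 - k == -1) = (k == 0))%R.
  by apply/eqP/eqP => e; apply: (lincomb (u := (-1)%R) e); ring.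
rewrite /key_label k0 k1 orbC; have [-> /=|kn0 /=] := eqVneq k 0%R.
  have -> : ((0 : 'F_p) == -1)%R = false by rewrite eq_sym oppr_eq0 oner_eq0.
  by rewrite m_inv.
have [_ //|kn1 /=] := eqVneq k (-1)%R.
have -> : ((- 2%:R - m) / 2%:R = - 1 - m / 2%:R)%R by field.
rewrite !small_rep_reflect m1 m_inv.
have -> : ((- 1 - k == h%:R) = (k == h%:R))%R.
  by rewrite -Fp_half; apply/eqP/eqP => e; apply: (lincomb (u := (-1)%R) e); ring.
case: s => //; case: ifP => kh; case: ifP => // _.
(* Away from the fixed point h exactly one of k and -1-k lies below h, so both keys retain the same
   trace. *)
congr LB1; rewrite /lower_half Fp_val_reflect.
have khn : nat_of_ord k <> h by move=> e; rewrite -e natr_Zp eqxx in kh.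
by rewrite (ltn_half_reflect half_p (Fp_val_lt k) khn) if_neg.
Qed.

Definition label_key (L : rb_label p) : 'F_p * 'F_p * bool * bool :=
  (match L with
   | LB1 k m => (k%:R, m, false, true)
   | LB2 k => (k%:R, -1, false, true)
   | LB3 m => (m%:R ^+ 2 / (2%:R * m%:R + 1), m%:R + m%:R, true, true)
   | LO1 m => (h%:R, m%:R, false, true)
   | LO2 => (h%:R, -1, false, true)
   | LB4 => (0, 0, true, false)
   | LB5 => (0, 0, false, false)
   | LB6 => (0, 0, false, true)
   | LB7 m => (0, m, false, false)
   | LB8 m => (0, m, false, true)
   end)%R.

Lemma Fp_nat_eq n n' : (n < p)%N -> (n' < p)%N ->
  ((n%:R : 'F_p) == n'%:R)%R = (n == n').
Proof.
move=> n_p n'_p; apply/eqP/eqP => [/(congr1 (@nat_of_ord _))|-> //].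
by rewrite !Fp_nat_val.
Qed.

Lemma Fp_N1 : (-1 : 'F_p)%R = (p - 1)%N%:R%R.
Proof. by rewrite natrB ?prime_gt0 // Fp_p_eq0 sub0r. Qed.

Lemma Fp_val_N1 (x : 'F_p) : x != (-1)%R -> nat_of_ord x != (p - 1)%N.
Proof. by apply: contraNneq => e; rewrite -[x]natr_Zp e Fp_N1. Qed.

Lemma Fp_val_eq0 (x : 'F_p) : x != 0%R -> (0 < x)%N.
Proof.
by move=> x0; rewrite lt0n; apply: contraNneq x0 => e; rewrite -[x]natr_Zp e.
Qed.

Lemma Fp_val_reflect2 (x : 'F_p) : x != (-1)%R ->
  nat_of_ord (- 2%:R - x)%R = (p - 2 - x)%N.
Proof.
move=> /Fp_val_N1 xn1; have x_p := Fp_val_lt x; have p1 := prime_gt1 p_pr.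
rewrite -[RHS]Fp_nat_val; last by lia.
congr nat_of_ord; rewrite -[in LHS](natr_Zp x).
apply/eqP; rewrite eq_sym -subr_eq0 !natrB ?Fp_p_eq0; [ | by lia | by lia].
by apply/eqP; ring.
Qed.

Lemma Fp_nat_neq0 n : (0 < n < p)%N -> (n%:R != 0 :> 'F_p)%R.
Proof.
by case/andP=> n0 n_p; rewrite -[0%R]/(0%:R)%R Fp_nat_eq ?prime_gt0 // -lt0n.
Qed.

Lemma Fp_nat_neqN1 n : (n < p - 1)%N -> (n%:R != -1 :> 'F_p)%R.
Proof.
have p1 := prime_gt1 p_pr.
by move=> n_p; rewrite Fp_N1 Fp_nat_eq; lia.
Qed.

Lemma Fp_odd_neq0 n : (n < h)%N -> (2%:R * n%:R + 1 != 0 :> 'F_p)%R.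
Proof.
move=> n_h; rewrite -natrM natr1 Fp_nat_neq0 //.
by have := half_p; lia.
Qed.

Lemma label_key_k L : label_ok L ->
  ((label_key L).1.1.1 != -1)%R /\ (((label_key L).1.1.1 == 0)%R =
  if L is (LB4 | LB5 | LB6 | LB7 _ | LB8 _) then true else false).
Proof.
have hp := half_p; have p2 := odd_prime_gt2 p_odd p_pr.
have k01 n : (0 < n < p - 1)%N -> (n%:R != -1 :> 'F_p)%R /\ (n%:R == 0 :> 'F_p)%R = false.
  move=> /andP[n0 n_p]; split; first exact: Fp_nat_neqN1.
  by apply/negbTE/Fp_nat_neq0; lia.
have z01 : (0 != -1 :> 'F_p)%R /\ (0 == 0 :> 'F_p)%R = true.
  by rewrite eqxx eq_sym oppr_eq0 oner_eq0.
case: L => [k m|k|m|m|||||m|m] //= okL; try exact: z01; try (apply: k01; lia).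
rewrite -/h in okL; have /Fp_odd_neq0 D0 : (m < h)%N by lia.
have m0 : (m%:R != 0 :> 'F_p)%R by apply: Fp_nat_neq0; lia.
have m1 : (m%:R + 1 != 0 :> 'F_p)%R by rewrite addr_eq0 Fp_nat_neqN1 //; lia.
split; last by apply/negbTE; rewrite mulf_neq0 ?invr_eq0 ?expf_neq0.
(* After clearing the denominator, k = -1 reads (m + 1)^2 = 0. *)
apply/eqP => /(congr1 (fun x => x * (2%:R * m%:R + 1) + (2%:R * m%:R + 1))%R).
rewrite divfK // => e; have /eqP := expf_neq0 2 m1; apply.
by apply: (lincomb (u := 1%R) e); ring.
Qed.

Lemma small_rep_nat n : (n < h)%N -> small_rep (-1)%R n%:R%R = n.
Proof.
have hp := half_p; move=> n_h; rewrite /small_rep Fp_val_reflect.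
by rewrite Fp_nat_val; lia.
Qed.

(** The index ranges of the list are exactly the canonical choices of [key_label]; this is what
    makes the list free of repetitions. *)
Lemma label_keyK L : label_ok L -> key_label (label_key L) = L.
Proof.
move=> okL; have [k1 k0] := label_key_k okL; move: k1 k0 okL.
have hp := half_p; rewrite /key_label.
case: L => [k m|k|m|m|||||m|m] /= k1 k0; rewrite ?k0 ?(negPf k1) ?eqxx /= -?/h => okL //.
- case/andP: okL => /andP[k_gt0 k_h] m1; rewrite (negPf m1).
  rewrite Fp_nat_eq; [ | lia | lia]; rewrite small_rep_nat // /lower_half Fp_nat_val; last by lia.
  by rewrite k_h ltn_eqF.
- case/andP: okL => k_gt0 k_h.
  rewrite Fp_nat_eq; [ | lia | lia]; rewrite small_rep_nat //.
  by rewrite ltn_eqF.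
- case/andP: okL => m_gt0 m_h.
  have -> : ((m%:R + m%:R) / 2%:R = m%:R :> 'F_p)%R by field.
  by rewrite small_rep_nat.
- have m1 : (m%:R != -1 :> 'F_p)%R by apply: Fp_nat_neqN1; lia.
  rewrite (negPf m1) /small_rep Fp_val_reflect2 // Fp_nat_val; last by lia.
  by congr LO1; lia.
- by rewrite (negPf okL).
- by rewrite (negPf okL).
Qed.

Lemma label_valid L : label_ok L -> valid_params (label_params L).
Proof.
case: L => [k m|k|m|m|||||m|m] okL; rewrite /valid_params /=; try by ring.
case/andP: okL => _ /Fp_odd_neq0 D0; by field.
Qed.

Lemma label_params_key L : label_ok L ->
  params_key (chi_sym (label_params L)) = label_key L.
Proof.
move=> okL; have [k1 k0] := label_key_k okL.
have ek : k_gamma (chi_sym (label_params L)) = (label_key L).1.1.1 by case: (L).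
have et : params_trace (chi_sym (label_params L)) = (label_key L).1.1.2.
  by case: (L) => * /=; rewrite /params_trace /= ?add0r ?addr0.
have es : params_scalar (chi_sym (label_params L)) = (label_key L).1.2.
  case: (L) okL => [k m|k|m|m|||||m|m] okL; rewrite /params_scalar /= ?oppr_eq0 ?oner_eq0 ?eqxx //=.
  - by rewrite eq_sym oppr_eq0 oner_eq0.
  - by rewrite eq_sym oppr_eq0 oner_eq0.
  - by rewrite eq_sym (negPf okL).
  - by rewrite eq_sym (negPf okL).
have er : params_range (chi_sym (label_params L)) = (label_key L).2.
  have [kn0|kn0] := eqVneq (label_key L).1.1.1 0%R; last first.
    rewrite params_range_unit ?ek //; last exact/valid_chi_sym/label_valid.
    by move: k0; rewrite (negPf kn0); case: (L).
  (* Each listed L with k = 0 has zero first column, so every vector in the row space has first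
     entry 0: [x_alpha] = 1 is out of range, and x = 0 is reached by z = 0. *)
  move: k0; rewrite kn0 eqxx; case: (L) => [k m|k|m|m|||||m|m] //= _.
  - apply/negbTE/params_rangeP => -[z1 [z2 [/= e1 _]]].
    have /eqP := oner_neq0 'F_p; apply.
    by apply: (lincomb (u := 1%R) e1); ring.
  - apply/negbTE/params_rangeP => -[z1 [z2 [/= e1 _]]].
    have /eqP := oner_neq0 'F_p; apply.
    by apply: (lincomb (u := 1%R) e1); ring.
  - by apply/params_rangeP; exists 0%R, 0%R => /=; split; ring.
  - apply/negbTE/params_rangeP => -[z1 [z2 [/= e1 _]]].
    have /eqP := oner_neq0 'F_p; apply.
    by apply: (lincomb (u := 1%R) e1); ring.
  - by apply/params_rangeP; exists 0%R, 0%R => /=; split; ring.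
rewrite /params_key ek et es er; by case: (label_key L) => [[[]]].
Qed.

Lemma nonunit_scalar_params (d : rb_params p) : valid_params d ->
  params_scalar d -> k_gamma d = 0%R ->
  d = (RBParams 0 0 0 0 (x_alpha d) (x_beta d) 0)%R.
Proof.
case: d => [la lb ma mb xa xb k]; rewrite /valid_params /params_scalar /=.
move=> vd /and3P[/eqP z1 /eqP z2 /eqP z3] k0; rewrite {}z1 {}z2 -{}z3 {}k0 in vd *.
have : (la * la == 0)%R by apply/eqP; apply: (lincomb (u := 1%R) vd); ring.
by rewrite mulf_eq0 orbb => /eqP->.
Qed.

Lemma key_has_label_aux (d : rb_params p) : valid_params d -> k_gamma d != (-1)%R ->
  d <> (RBParams 0 0 0 0 0 0 0)%R ->
  exists2 L, label_ok L & label_key L = params_key d \/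
    label_key L = params_key (params_tilde d).
Proof.
move=> vd k1 d0; have hp := half_p; have p2 := odd_prime_gt2 p_odd p_pr.
rewrite params_tilde_key.
have [k0|k0] := eqVneq (k_gamma d) 0%R.
  have [sd|sd] := boolP (params_scalar d).
    exists LB4 => //; left; have dE := nonunit_scalar_params vd sd k0.
    rewrite dE /params_key; congr (_, _, _, _) => /=.
    - by rewrite /params_trace /= addr0.
    (* Here k - L = 0, so x in its row space would give the excluded zero tuple. *)
    apply/esym/negbTE/params_rangeP => -[z1 [z2 /= [e1 e2]]].
    by apply: d0; rewrite dE e1 e2; congr RBParams; ring.
  have [m0|m0] := eqVneq (params_trace d) 0%R.
    exists (if params_range d then LB6 else LB5); first by case: ifP.
    by left; rewrite /label_key /params_key k0 m0 ?(negPf sd); case: ifP.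
  exists (if params_range d then LB8 (params_trace d) else LB7 (params_trace d)).
    by case: ifP.
  by left; rewrite /label_key /params_key k0 ?(negPf sd); case: ifP.
have rd := params_range_unit vd k0 k1; rewrite rd.
have [sd|sd] := boolP (params_scalar d).
  have [la [ela elb ema emb]] : exists la, [/\ l_alpha d = la, l_beta d = 0,
      m_alpha d = 0 & m_beta d = la]%R.
    by case/and3P: sd => /eqP? /eqP? /eqP?; exists (l_alpha d).
  have := vd; rewrite /valid_params ela elb ema emb => e.
  (* If 2l + 1 = 0, validity l^2 = k (2l + 1) gives l = 0 and then 1 = 0. *)
  have D0 : (2%:R * la + 1 != 0)%R.
    apply/eqP => D0; have : (la * la == 0)%R.
      by apply/eqP; apply: (lincomb2 (u := 1%R) (v := k_gamma d) e D0); ring.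
    rewrite mulf_eq0 orbb => /eqP la0; move: D0.
    by rewrite la0 mulr0 add0r => /eqP; rewrite oner_eq0.
  have la0 : la != 0%R.
    apply: contraNneq k0 => la0; apply/eqP; rewrite la0 in e.
    by apply: (lincomb (u := (-1)%R) e); ring.
  have la1 : la != (-1)%R.
    apply: contraNneq k1 => la1; apply/eqP; rewrite la1 in e.
    by apply: (lincomb (u := 1%R) e); ring.
  have ek : (k_gamma d = la ^+ 2 / (2%:R * la + 1))%R.
    apply: (mulIf D0); rewrite divfK //.
    by apply: (lincomb (u := (-1)%R) e); ring.
  have lap := Fp_val_lt la; have lav0 := Fp_val_eq0 la0.
  have lav1 := Fp_val_N1 la1.
  have lah : nat_of_ord la <> h.
    move=> eh; case/eqP: D0; rewrite -(natr_Zp la) eh.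
    by apply: (lincomb (u := 1%R) Fp_half); ring.
  rewrite /params_key /params_trace ela emb.
  have [la_h|la_h] := ltnP la h.
    exists (LB3 p la); first by rewrite /label_ok -/h lav0.
    by left; rewrite /label_key natr_Zp sd rd ek.
  exists (LB3 p (p - 1 - la)).
    exact: reflect_lower_half hp lap lav1 la_h lah.
  right; rewrite /label_key -Fp_val_reflect natr_Zp ek.
  congr (_, _, _, _); last by ring.
  exact: scalar_key_reflect.
have kp := Fp_val_lt (k_gamma d); have kv0 := Fp_val_eq0 k0.
have kv1 := Fp_val_N1 k1.
have krE : ((p - 1 - k_gamma d)%N%:R = - 1 - k_gamma d)%R.
  by rewrite -Fp_val_reflect natr_Zp.
have [kh|kh] := eqVneq (k_gamma d) h%:R%R.
  have [m1|m1] := eqVneq (params_trace d) (-1)%R.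
    exists LO2 => //; left.
    by rewrite /label_key /params_key kh m1 ?(negPf sd) rd.
  have [mh|mh] := ltnP (params_trace d) h.
    exists (LO1 p (params_trace d)) => //; left.
    by rewrite /label_key /params_key kh natr_Zp ?(negPf sd) rd.
  have mp := Fp_val_lt (params_trace d); have mv1 := Fp_val_N1 m1.
  (* At k = h tilde fixes k and reflects only the trace; the representative of -2 - m is p - 2 - m
     because m differs from -1. *)
  exists (LO1 p (p - 2 - params_trace d)); first by rewrite /label_ok -/h; lia.
  right; rewrite /label_key -Fp_val_reflect2 // natr_Zp ?(negPf sd) kh.
  by rewrite -Fp_half addrK.
have khn : nat_of_ord (k_gamma d) <> h.
  by move=> e; rewrite -e natr_Zp eqxx in kh.
have [k_h|k_h] := ltnP (k_gamma d) h.
  have [m1|m1] := eqVneq (params_trace d) (-1)%R.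
    exists (LB2 p (k_gamma d)) => /=; first by rewrite kv0.
    by left; rewrite /label_key /params_key natr_Zp m1 ?(negPf sd) rd.
  exists (LB1 (k_gamma d) (params_trace d)) => /=; first by rewrite kv0 k_h.
  by left; rewrite /label_key /params_key natr_Zp ?(negPf sd) rd.
have [m1|m1] := eqVneq (params_trace d) (-1)%R.
  exists (LB2 p (p - 1 - k_gamma d)); first by rewrite /label_ok -/h; lia.
  right; rewrite /label_key krE m1 ?(negPf sd); congr (_, _, _, _); ring.
exists (LB1 (p - 1 - k_gamma d) (- 2%:R - params_trace d)%R).
  rewrite /label_ok -/h; apply/andP; split; first by lia.
  apply: contraNneq m1 => e; apply/eqP; apply: (lincomb (u := (-1)%R) e); ring.
by right; rewrite /label_key krE ?(negPf sd).
Qed.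

Lemma key_has_label (d : rb_params p) : valid_params d ->
  d <> (RBParams 0 0 0 0 0 0 0)%R -> params_tilde d <> (RBParams 0 0 0 0 0 0 0)%R ->
  exists2 L, label_ok L & label_key L = params_key d \/
    label_key L = params_key (params_tilde d).
Proof.
move=> vd d0 td0; have [k1|k1] := eqVneq (k_gamma d) (-1)%R; last first.
  exact: key_has_label_aux.
have [|L okL eL] := key_has_label_aux (valid_params_tilde vd) _ td0.
  have -> : (k_gamma (params_tilde d) = - 1 - k_gamma d)%R by case: (d).
  by rewrite k1 subrr eq_sym oppr_eq0 oner_eq0.
by exists L => //; rewrite params_tildeK in eL; case: eL; [right | left].
Qed.

End Representatives.

(** * Completeness and invariance of the labels on orbits *)

Section Orbits.

Variables (p : nat) (gT : finGroupType) (S : 'F_p -> 'F_p -> 'F_p -> gT).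
Hypotheses (p_pr : prime p) (p_odd : odd p) (coS : heis_coords S).

Lemma nontrivial_params d (B : {ffun gT -> gT}) :
  sym_params S d B -> ~ rb_trivial B ->
  d <> (RBParams 0 0 0 0 0 0 0)%R /\ params_tilde d <> (RBParams 0 0 0 0 0 0 0)%R.
Proof.
move=> dB ntB; split=> [d0|/(congr1 (@params_tilde p))]; last rewrite params_tildeK => d0.
  apply: ntB; left=> g; have [t [s [r ->]]] := coords_onto coS g.
  by rewrite dB d0 /= -(coords1 p_pr p_odd coS); apply: coords_eq; ring.
apply: ntB; right=> g; have [t [s [r ->]]] := coords_onto coS g.
rewrite dB d0 /= (coordsV p_pr p_odd coS).
by apply: coords_eq; ring.
Qed.

(** In the remaining case, L scalar and k = 0, validity gives L = 0, the row space is zero, and x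
    out of range means x nonzero, so both tuples move to x = (1, 0). *)
Lemma key_params_equiv d d' : valid_params d -> valid_params d' ->
  k_gamma d != (-1)%R ->
  (params_scalar d -> k_gamma d = 0%R -> ~~ params_range d) ->
  params_key d = params_key d' -> params_equiv S d d'.
Proof.
move=> vd vd' k1 nr eqk; have [ek et es er] := params_keyP eqk.
have [sd|ns] := boolP (params_scalar d); last exact: nonscalar_key_equiv.
have [k0|k0] := eqVneq (k_gamma d) 0%R; last exact: scalar_key_equiv.
have {nr} := nr sd k0 => nr.
have nonzero e : valid_params e -> params_scalar e -> k_gamma e = 0%R ->
    ~~ params_range e -> params_equiv S e (RBParams 0 0 0 0 1 0 0)%R.
  move=> ve se ke re; have eE := nonunit_scalar_params ve se ke.
  rewrite eE; apply: zero_params_equiv => //.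
  rewrite -negb_and; apply: contraNN re => /andP[/eqP xa0 /eqP xb0].
  by rewrite eE xa0 xb0; apply/params_rangeP; exists 0%R, 0%R => /=; split; ring.
apply: (params_equiv_trans coS (nonzero d vd sd k0 nr)).
by apply/params_equiv_sym/nonzero => //; rewrite -?es -?ek -?er.
Qed.

(** As a relation it applies to arbitrary maps, and its invariance is a logical equivalence, which
    passes directly to the reflexive, symmetric and transitive closure. *)
Definition orbit_label (B : {ffun gT -> gT}) (l : rb_label p) : Prop :=
  exists2 d, sym_params S d B & key_label (params_key d) = l.

Lemma rb_step_orbit_label B B' l :
  rb_step B B' -> orbit_label B l <-> orbit_label B' l.
Proof.
case=> rbB rbB' step.
have [d vd dB] := rota_baxter_sym_params p_pr p_odd coS rbB.
have [d' vd' dB'] := rota_baxter_sym_params p_pr p_odd coS rbB'.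
have eql : key_label (params_key d) = key_label (params_key d').
  case: step => [[phi phiA eB']|eB']; rewrite {}eB' in dB'.
    by rewrite (params_conj_key (params_conj_of_aut p_pr p_odd coS phiA dB dB')).
  rewrite (sym_params_inj p_pr p_odd coS dB' (sym_params_tilde p_pr p_odd coS dB)).
  by rewrite params_tilde_key key_label_tilde.
split=> -[e eB <-].
  by exists d' => //; rewrite -eql (sym_params_inj p_pr p_odd coS dB eB).
by exists d => //; rewrite eql (sym_params_inj p_pr p_odd coS dB' eB).
Qed.

Lemma rb_equiv_orbit_label B B' l :
  rb_equiv B B' -> orbit_label B l <-> orbit_label B' l.
Proof.
elim=> [B1 B2 st|B1|B1 B2 _ IH|B1 B2 B3 _ IH1 _ IH2] //.
- exact: rb_step_orbit_label.
- by symmetry.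
- exact: iff_trans IH1 IH2.
Qed.

End Orbits.

Theorem theorem3 (p : nat) (gT : finGroupType) (a b c : gT)
    (p_prime : prime p) (p_odd : odd p) (H3 : heisenberg p a b c) :
  [/\ forall L : rb_label p, label_ok L ->
        exists B : {ffun gT -> gT}, listed_operator a b c L B,
      forall B : {ffun gT -> gT}, rota_baxter B -> ~ rb_trivial B ->
        exists (L : rb_label p) (B0 : {ffun gT -> gT}),
          listed_operator a b c L B0 /\ rb_equiv B B0
    & forall (L1 L2 : rb_label p) (B1 B2 : {ffun gT -> gT}),
        listed_operator a b c L1 B1 -> listed_operator a b c L2 B2 ->
        L1 <> L2 -> ~ rb_equiv B1 B2].
Proof.
have coS := sym_elt_coords p_prime p_odd H3.
set S : 'F_p -> 'F_p -> 'F_p -> gT := sym_elt a b c in coS.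
have listed (L : rb_label p) : label_ok L -> exists2 B : {ffun gT -> gT},
    listed_operator a b c L B & sym_params S (chi_sym (label_params L)) B.
  move=> okL; have vL := label_valid p_prime p_odd okL.
  have [B dB] := sym_params_exists coS (chi_sym (label_params L)).
  exists B => //; split=> //; last exact: has_chi_sym.
  by apply: sym_params_rota_baxter dB => //; apply/valid_chi_sym.
split.
- by move=> L /listed[B]; exists B.
- move=> B rbB ntB.
  have [d vd dB] := rota_baxter_sym_params p_prime p_odd coS rbB.
  have [d0 td0] := nontrivial_params p_prime p_odd coS dB ntB.
  have [L okL eL] := key_has_label p_prime p_odd vd d0 td0.
  have [B0 listedB0 dB0] := listed L okL; exists L, B0; split=> //.
  have keyL := label_params_key p_prime p_odd okL.
  have vL : valid_params (chi_sym (label_params L)).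
    exact/valid_chi_sym/label_valid.
  have equivL e : valid_params e -> label_key L = params_key e ->
      params_equiv S (chi_sym (label_params L)) e.
    move=> ve eqe; have [k1 k0] := label_key_k p_prime p_odd okL.
    have e1 := congr1 (fun x => x.1.1.1) keyL; have e2 := congr1 snd keyL.
    have e3 := congr1 (fun x => x.1.2) keyL; rewrite /= in e1 e2 e3.
    apply: key_params_equiv => //; [by rewrite e1 | | by rewrite keyL].
    (* Among the labels with scalar L only [LB4] has k = 0, and its x is out of range. *)
    by rewrite e1 e2 e3; case: (L) k0 => //= m k0 _ /eqP; rewrite k0.
  suff equiv_d : params_equiv S (chi_sym (label_params L)) d.
    exact: rst_sym (equiv_d _ _ dB0 dB).
  case: eL => eL; first exact: equivL.
  apply: (params_equiv_trans coS) (equivL _ (valid_params_tilde vd) eL) _.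
  exact/params_equiv_sym/params_equiv_tilde.
move=> L1 L2 B1 B2 listed1 listed2 neqL /(rb_equiv_orbit_label p_prime p_odd coS L1).
have label_of L B : listed_operator a b c L B ->
    sym_params S (chi_sym (label_params L)) B /\
    key_label (params_key (chi_sym (label_params L))) = L.
  case=> okL rbB chiB; split; last by rewrite label_params_key ?label_keyK.
  exact: sym_has_chi (label_valid _ _ _) chiB.
have [dB1 e1] := label_of _ _ listed1; have [dB2 e2] := label_of _ _ listed2.
case=> + _; case=> [|d dB2' eL1].
  by exists (chi_sym (label_params L1)).
apply: neqL; rewrite -eL1 (sym_params_inj p_prime p_odd coS dB2' dB2).
by rewrite e2.
Qed.
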